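(* Let $K$ be an algebraically closed field that is complete with respect to a non-trivial and non-archimedean absolute value. Then for every compact subset $E$ in $\mathsf{P}^1=\mathsf{P}^1(K)$ having the (non-infinitesimal) lower capacity density property and every $\mathcal{S}_0\in\mathsf{P}^1\setminus E$ with $\operatorname{Cap}_{\mathcal{S}_0}(E)>0$, denoting by $D_{\mathcal{S}_0}$ the component of $\mathsf{P}^1\setminus E$ containing $\mathcal{S}_0$, there are $\alpha>0$ and $\delta_0>0$ such that $$\sup_{a\in(\partial D_{\mathcal{S}_0})\cap\mathbb{P}^1}\ \sup_{\delta\in(0,\delta_0]}\ \frac{\sup_{\mathsf{B}_\#(a,\delta)}\bigl(p_{\mathcal{S}_0,\nu_{\mathcal{S}_0,E}}(\cdot)-\log\operatorname{Cap}_{\mathcal{S}_0}(E)\bigr)}{\delta^\alpha}<+\infty.$$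
   Context: $K$ has arbitrary characteristic. **Berkovich projective line.** $\mathbb{P}^1=\mathbb{P}^1(K)=K\cup\{\infty\}$, and $\mathsf{P}^1=\mathsf{P}^1(K)$ is its Berkovich analytification, with its usual (weak) topology; it is compact, Hausdorff and uniquely arcwise connected, and $\mathbb{P}^1$ is dense in it. A $K$-closed disk is $B(a,r)=\{z\in K:|z-a|\le r\}$, $a\in K$, $r\ge 0$. Points of $\mathsf{P}^1$: type I points are the points of $\mathbb{P}^1$ (with $a\in K$ identified with $B(a,0)$); type II (resp. type III) points correspond to the $K$-closed disks of radius $r\in|K^*|$ (resp. $r\in\mathbb{R}_{>0}\setminus|K^*|$); type IV points are the (cofinal equivalence classes of) decreasing nested sequences of $K$-closed disks with empty intersection. Set $\mathsf{A}^1=\mathsf{P}^1\setminus\{\infty\}$. Inclusion of disks extends to a partial order $\preceq$ on $\mathsf{P}^1$ with maximum element $\infty$ and with minimal elements exactly the points of $K$ and the type IV points; any two points have a least upper bound $\mathcal{S}\wedge\mathcal{S}'$. The function $\operatorname{diam}:\mathsf{P}^1\to[0,+\infty]$ is the radius of the corresponding disk for points of types I, II, III other than $\infty$, the limit of the radii for type IV points, and $\operatorname{diam}\infty=+\infty$. **Kernels.** The chordal metric on $\mathbb{P}^1$ is $[z,w]=|p_0q_1-p_1q_0|/(\max\{|p_0|,|p_1|\}\max\{|q_0|,|q_1|\})$ for homogeneous coordinates $(p_0,p_1)$ of $z$ and $(q_0,q_1)$ of $w$; so $[z,w]=|z-w|/(\max\{1,|z|\}\max\{1,|w|\})$ on $K\times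 K$. $[\mathcal{S},\mathcal{S}']_g$ denotes its unique upper semicontinuous and separately continuous extension to $\mathsf{P}^1\times\mathsf{P}^1$. For $\mathcal{S}_0\in\mathsf{P}^1$, the generalized Hsia kernel with respect to $\mathcal{S}_0$ is $[\mathcal{S},\mathcal{S}']_{\mathcal{S}_0}=[\mathcal{S},\mathcal{S}']_g/([\mathcal{S},\mathcal{S}_0]_g[\mathcal{S}',\mathcal{S}_0]_g)$ on $\mathsf{P}^1\times\mathsf{P}^1$, with the convention $1/0=0/(0^2)=+\infty$. For $\mathcal{S}_0=\infty$ it is written $|\mathcal{S}-\mathcal{S}'|_\infty$; it equals $\operatorname{diam}(\mathcal{S}\wedge\mathcal{S}')$ on $\mathsf{A}^1\times\mathsf{A}^1$ and $+\infty$ if one of the points is $\infty$. The Berkovich chordal closed ball centered at $a\in\mathbb{P}^1$ is $\mathsf{B}_\#(a,r)=\{\mathcal{S}\in\mathsf{P}^1:[\mathcal{S},a]_g\le r\}$ (only $r\le 1$ is of interest). **Potential theory.** For a positive Radon measure $\nu$ on $\mathsf{P}^1$ supported in $\mathsf{P}^1\setminus\{\mathcal{S}_0\}$, its logarithmic potential with respect to $\mathcal{S}_0$ is $p_{\mathcal{S}_0,\nu}(\cdot)=\int_{\mathsf{P}^1}\log[\cdot,\mathcal{S}']_{\mathcal{S}_0}\,d\nu(\mathcal{S}')$ and its energy is $I_{\mathcal{S}_0,\nu}=\int_{\mathsf{P}^1} p_{\mathcal{S}_0,\nu}\,d\nu\in[-\infty,+\infty)$. For $C\subset\mathsf{P}^1$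 and $\mathcal{S}_0\in\mathsf{P}^1\setminus C$, $V_{\mathcal{S}_0}(C)=\sup_\nu I_{\mathcal{S}_0,\nu}$ over all probability Radon measures $\nu$ on $\mathsf{P}^1$ supported by $C$ ($\sup\emptyset=-\infty$ here), and the logarithmic capacity is $\operatorname{Cap}_{\mathcal{S}_0}(C)=\exp(V_{\mathcal{S}_0}(C))$. For compact $E\subset\mathsf{P}^1$ and $\mathcal{S}_0\in\mathsf{P}^1\setminus E$ with $\operatorname{Cap}_{\mathcal{S}_0}(E)>0$, $\nu_{\mathcal{S}_0,E}$ denotes the equilibrium mass distribution on $E$ with respect to $\mathcal{S}_0$: the unique probability Radon measure $\nu$ on $\mathsf{P}^1$ with $\operatorname{supp}\nu\subset E$ and $I_{\mathcal{S}_0,\nu}=V_{\mathcal{S}_0}(E)$. One has $p_{\mathcal{S}_0,\nu_{\mathcal{S}_0,E}}-\log\operatorname{Cap}_{\mathcal{S}_0}(E)\ge 0$ on $\mathsf{P}^1$; if $(\partial D_{\mathcal{S}_0})\cap\mathbb{P}^1=\emptyset$ the assertion is vacuous. **Lower capacity density.** For non-empty $E\subset\mathsf{P}^1$, $\operatorname{diam}_\infty E=\sup\{|\mathcal{S}-\mathcal{S}'|_\infty:\mathcal{S},\mathcal{S}'\in E\}\in[0,+\infty]$ (so it is $+\infty$ if $\infty\in E$). For $\mathcal{S}\in\mathsf{A}^1$ and $r\ge\operatorname{diam}\mathcal{S}$, $\mathsf{B}(\mathcal{S},r)=\{\mathcal{S}'\in\mathsf{A}^1:|\mathcal{S}'-\mathcal{S}|_\infty\le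 r\}$. A compact subset $E$ of $\mathsf{P}^1$ has the (non-infinitesimal) lower capacity density property if there is $c\in(0,1)$ such that for every $\mathcal{S}\in E\setminus\{\infty\}$ and every $r\in(\operatorname{diam}\mathcal{S},\operatorname{diam}_\infty E)$, $\operatorname{Cap}_\infty(E\cap\mathsf{B}(\mathcal{S},r))\ge cr$. *)

(* Defs.v *)
From HB Require Import structures.
From mathcomp Require Import all_boot all_order all_algebra.
From mathcomp Require Import all_classical all_reals all_analysis.
Import Order.TTheory GRing.Theory Num.Theory.
Import numFieldNormedType.Exports.

Set Implicit Arguments.
Unset Strict Implicit.
Unset Printing Implicit Defensive.

Local Open Scope classical_set_scope.
Local Open Scope ring_scope.

Record absolute_value (R : realType) (K : fieldType) := AbsoluteValue {
  absv :> K -> R ;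
  absv_ge0 : forall x, 0 <= absv x ;
  absv_eq0 : forall x, absv x = 0 <-> x = 0 ;
  absvM : forall x y, absv (x * y) = absv x * absv y ;
  absvD : forall x y, absv (x + y) <= absv x + absv y }.

Section AbsoluteValue.
Context {R : realType} {K : fieldType} (v : absolute_value R K).

Definition nonarchimedean_abs := forall x y : K, v (x + y) <= Num.max (v x) (v y).

Definition nontrivial_abs := exists x : K, x != 0 /\ v x != 1.

Definition complete_abs := forall u : nat -> K,
  (forall e : R, 0 < e ->
     exists N, forall m n, (N <= m)%N -> (N <= n)%N -> v (u m - u n) < e) ->
  exists l : K, (fun n => v (u n - l)) @ \oo --> (0 : R).

(* Multiplicative seminorms on K[T] extending the absolute value of K: the
   points of the Berkovich affine line. *)
Record mul_seminorm := MulSeminorm {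
  msn :> {poly K} -> R ;
  msn_ge0 : forall f, 0 <= msn f ;
  msnC : forall c, msn c%:P = v c ;
  msnM : forall f g, msn (f * g) = msn f * msn g ;
  msnD : forall f g, msn (f + g) <= msn f + msn g }.

HB.instance Definition _ := gen_eqMixin mul_seminorm.
HB.instance Definition _ := gen_choiceMixin mul_seminorm.

(* The coarsest topology for which every S |-> |f|_S, f in K[T], is
   continuous. *)
Definition berkA1 : Type :=
  @initial_topology mul_seminorm {ptws {poly K} -> R} msn.

HB.instance Definition _ := Topological.on berkA1.

(* None is the point oo. *)
Definition berkP1 : Type := one_point_compactification berkA1.

HB.instance Definition _ := Topological.on berkP1.
HB.instance Definition _ := Pointed.on berkP1.

Definition binfty : berkP1 := None.

Section TypeI.
Variable z : K.
Let ev (f : {poly K}) : R := v f.[z].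

Let ev_ge0 f : 0 <= ev f. Proof. exact: absv_ge0. Qed.

Let evC c : ev c%:P = v c. Proof. by rewrite /ev hornerC. Qed.

Let evM f g : ev (f * g) = ev f * ev g.
Proof. by rewrite /ev hornerM absvM. Qed.

Let evD f g : ev (f + g) <= ev f + ev g.
Proof. by rewrite /ev hornerD; exact: absvD. Qed.

Definition typeI_seminorm : mul_seminorm := MulSeminorm ev_ge0 evC evM evD.
End TypeI.

(* The classical projective line is K + {oo} = option K. *)
Definition typeI (z : option K) : berkP1 :=
  if z is Some z' then Some (typeI_seminorm z' : berkA1) else None.

Definition hcoord (z : option K) : K * K :=
  if z is Some z' then (z', 1) else (1, 0).

Definition chordal (z w : option K) : R :=
  let p := hcoord z in let q := hcoord w in
  v (p.1 * q.2 - p.2 * q.1) /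
    (Num.max (v p.1) (v p.2) * Num.max (v q.1) (v q.2)).

Definition chordal_extension (g : berkP1 -> berkP1 -> R) :=
  [/\ forall z w, g (typeI z) (typeI w) = chordal z w,
      forall r : R, open [set p : berkP1 * berkP1 | g p.1 p.2 < r],
      forall S, continuous (fun S' => g S S')
    & forall S', continuous (fun S => g S S')].

(* [S, S']_g; the extension exists and is unique. *)
Definition chordal_kernel : berkP1 -> berkP1 -> R :=
  xget (fun _ _ => 0) [set g | chordal_extension g].

Definition hsia (S0 S S' : berkP1) : \bar R :=
  let d := chordal_kernel S S0 * chordal_kernel S' S0 in
  if d == 0 then +oo%E else (chordal_kernel S S' / d)%:E.

Definition chordal_ball (a : option K) (r : R) : set berkP1 :=
  [set S | chordal_kernel S (typeI a) <= r].

Definition Kdisk (a : K) (r : R) : set K := [set z | v (z - a) <= r].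

Definition disk_norm (B : set K) (f : {poly K}) : R :=
  sup [set v f.[z] | z in B].

(* Points of types I, II and III: d is the radius of the disk. *)
Definition disk_point_radius (S : berkA1) (d : R) := exists a : K,
  0 <= d /\ forall f : {poly K}, msn S f = disk_norm (Kdisk a d) f.

(* Points of type IV: d is the limit of the radii. *)
Definition typeIV_radius (S : berkA1) (d : R) :=
  exists (a : nat -> K) (r : nat -> R),
  [/\ forall n, 0 <= r n,
      forall n, Kdisk (a n.+1) (r n.+1) `<=` Kdisk (a n) (r n),
      \bigcap_n Kdisk (a n) (r n) = set0,
      forall f : {poly K},
        (fun n => disk_norm (Kdisk (a n) (r n)) f) @ \oo --> msn S f
    & r @ \oo --> d].

Definition diam (S : berkP1) : \bar R :=
  if S is Some S' then
    (xget 0 [set d | disk_point_radius S' d \/ typeIV_radius S' d])%:E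
  else +oo%E.

Definition borelP1 : Type := g_sigma_algebraType (@open berkP1).

HB.instance Definition _ := Measurable.on borelP1.

(* Inner regularity is required explicitly: the Berkovich line need not be
   metrizable. For finite Borel measures on a compact Hausdorff space this is
   equivalent to regularity. *)
Definition radon (nu : {measure set borelP1 -> \bar R}) :=
  forall A : set borelP1, measurable A ->
    nu A = ereal_sup [set nu C | C in
                        [set C : set berkP1 | compact C /\ C `<=` A]].

Definition msupport (nu : {measure set borelP1 -> \bar R}) : set berkP1 :=
  [set S | forall U : set berkP1, open U -> U S -> (0 < nu U)%E].

Definition potential (S0 : berkP1) (nu : {measure set borelP1 -> \bar R})
    (S : berkP1) : \bar R :=
  (\int[nu]_(S' in setT) lne (hsia S0 S S'))%E.

Definition energy (S0 : berkP1) (nu : {measure set borelP1 -> \bar R}) :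
    \bar R :=
  (\int[nu]_(S in setT) potential S0 nu S)%E.

Definition robin (S0 : berkP1) (C : set berkP1) : \bar R :=
  ereal_sup [set energy S0 nu | nu in
    [set nu : probability borelP1 R | radon nu /\ msupport nu `<=` C]].

Definition capacity (S0 : berkP1) (C : set berkP1) : \bar R :=
  expeR (robin S0 C).

Definition equilibrium (S0 : berkP1) (E : set berkP1)
    (nu : probability borelP1 R) :=
  [/\ radon nu, msupport nu `<=` E & energy S0 nu = robin S0 E].

Definition diam_infty (E : set berkP1) : \bar R :=
  ereal_sup [set x | exists S S', [/\ E S, E S' & x = hsia binfty S S']].

Definition berk_ball (S : berkP1) (r : R) : set berkP1 :=
  [set S' | S' <> binfty /\ (hsia binfty S' S <= r%:E)%E].

Definition lower_capacity_density (E : set berkP1) :=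
  exists c : R, [/\ 0 < c, c < 1 &
    forall (S : berkP1) (r : R), E S -> S <> binfty ->
      (diam S < r%:E)%E -> (r%:E < diam_infty E)%E ->
      ((c * r)%:E <= capacity binfty (E `&` berk_ball S r))%E].

Definition frontier (A : set berkP1) : set berkP1 := closure A `\` A^°.

End AbsoluteValue.

(* Main.v *)
(* By the variation of the energy, the lower capacity density gives test
   measures of energy at least log d - C on E inside the chordal ball of radius
   d around a boundary point, up to the normalisation at S0. Comparing the
   equilibrium measure nu with the measure obtained by replacing its mass
   n(d) inside the ball by such a test measure bounds the excess u(d) of the
   energy gap over the gap seen from the ball: u(d) <= C n(d). As u bounds the
   Green potential on the ball and u(d) - u(d') >= n(d') log(d/d'), iterating
   over d = e d' forces u to decay like a power of d.

   Throughout, kernels are truncated to gaps max(0, M - log k), so that all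
   integrals are of nonnegative functions. *)

From HB Require Import structures.
Require Import Defs.
From mathcomp Require Import all_boot all_order all_algebra.
From mathcomp Require Import finmap.
From mathcomp Require Import all_classical all_reals all_analysis.
From mathcomp Require Import measurable_realfun.
From mathcomp Require Import ring lra.
Import Order.TTheory GRing.Theory Num.Theory.
Import numFieldNormedType.Exports.

Set Implicit Arguments.
Unset Strict Implicit.
Unset Printing Implicit Defensive.

Local Open Scope classical_set_scope.
Local Open Scope ring_scope.

(** * Absolute values and the chordal metric *)

(** The kernel is handled through [chordal_extension], mostly through separate continuity, so
    inequalities are proved at type I points and carried over by density one variable at a time. Two
    of them drive everything. The ultrametric inequality makes a chordal ball look like one point
    from outside: the interaction of an outer mass with an inner one depends only on the inner total
    mass, and the energy becomes a quadratic form in two coefficients. Ptolemy's inequality becomes,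
    after division, the ultrametric inequality for the kernel based at any [S0].

    The potential need not equal log Cap at a given boundary point, so only minimality of the energy
    is used. As the energy of nu restricted to the ball is unknown, two competitors are needed: one
    bounds that energy by the test measure, the other gives a first-order condition on shifting mass
    across the edge of the ball.

    The density property concerns finite points and the kernel based at oo. When oo lies in E, test
    measures near oo must be built from finite points of E at comparable distance from oo. *)

Section AbsoluteValue.
Context {R : realType} {K : closedFieldType} (v : absolute_value R K).

Lemma absv0 : v 0 = 0.
Proof. exact/(absv_eq0 v). Qed.

Lemma absv_gt0 x : (0 < v x) = (x != 0).
Proof.
rewrite lt_def absv_ge0 andbT; congr negb.
by apply/eqP/eqP => /(absv_eq0 v).
Qed.

Lemma absv1 : v 1 = 1.
Proof.
have /mulfI : v 1 != 0 by rewrite gt_eqF// absv_gt0 oner_neq0.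
by apply; rewrite -absvM !mulr1.
Qed.

Lemma absvX x n : v (x ^+ n) = v x ^+ n.
Proof. by elim: n => [|n ih]; rewrite ?expr0 ?absv1// !exprS absvM ih. Qed.

Lemma absvV x : v x^-1 = (v x)^-1.
Proof.
have [->|x0] := eqVneq x 0; first by rewrite invr0 absv0 invr0.
have vx0 : v x != 0 by rewrite gt_eqF// absv_gt0.
by apply: (mulfI vx0); rewrite -absvM !divff// absv1.
Qed.

Lemma absvN x : v (- x) = v x.
Proof.
apply/eqP; rewrite -(@eqrXn2 _ 2) ?absv_ge0//.
by rewrite -!absvX sqrrN.
Qed.

Lemma absvB x y : v (x - y) = v (y - x).
Proof. by rewrite -absvN opprB. Qed.

Lemma exists_nth_root (x : K) n : exists y, y ^+ n.+1 = x.
Proof.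
have [y yE] := solve_monicpoly (fun i => if i == 0%N then x else 0) (ltn0Sn n).
exists y; rewrite yE (bigD1 ord0)//= expr0 mulr1 big1 ?addr0//.
by move=> [[|i] ilt]// _ /=; rewrite mul0r.
Qed.

Lemma bernoulli (x : R) n : -1 <= x -> 1 + n%:R * x <= (1 + x) ^+ n.
Proof.
move=> x1; elim: n => [|n ih]; first by rewrite mul0r addr0 expr0.
rewrite exprS; have x10 : 0 <= 1 + x by lra.
apply: le_trans (ler_wpM2l x10 ih).
have := sqr_ge0 x; rewrite -natr1.
have : (0:R) <= n%:R by [].
nra.
Qed.

Hypothesis v_nontrivial : nontrivial_abs v.

(** The value group is divisible because K is algebraically closed, hence dense: an element of value
    above 1 has a root y with 1 < |y| < r/s, and consecutive powers of y cannot jump over the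
    interval. *)
Lemma absv_between (s r : R) : 0 <= s -> s < r -> exists x : K, s < v x < r.
Proof.
move=> s0 sr.
wlog {s0} s0 : s sr / 0 < s.
  move=> hw; have [s_gt0|s_le0] := ltP 0 s; first exact: hw.
  have [x /andP[? ?]] := hw (r / 2) ltac:(lra) ltac:(lra).
  by exists x; apply/andP; split; lra.
have [x [x0 x1]] : exists x, x != 0 /\ 1 < v x.
  case: v_nontrivial => x [x0]; rewrite neq_lt => /orP[x1|x1]; last by exists x.
  exists x^-1; rewrite invr_eq0; split => //.
  by rewrite absvV invf_gt1// absv_gt0.
have qgt1 : 1 < r / s by rewrite ltr_pdivlMr// mul1r.
have [y [y1 yq]] : exists y, 1 < v y /\ v y < r / s.
  set e := r / s - 1.
  have e0 : 0 < e by rewrite /e; lra.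
  pose n := Num.truncn (v x / e).
  have nP : v x / e < n.+1%:R by rewrite truncnS_gt.
  have [y yE] := exists_nth_root x n.
  have vy : v y ^+ n.+1 = v x by rewrite -absvX yE.
  exists y; split.
    rewrite ltNge; apply/negP => y1.
    have : v y ^+ n.+1 <= 1 by rewrite exprn_ile1// absv_ge0.
    by rewrite vy leNgt x1.
  rewrite ltNge; apply/negP => yq.
  have : (r / s) ^+ n.+1 <= v x.
    by rewrite -vy lerXn2r ?nnegrE ?absv_ge0//; lra.
  have := @bernoulli e n.+1 ltac:(lra).
  have -> : 1 + e = r / s by rewrite /e; ring.
  move: nP; rewrite ltr_pdivrMr//; lra.
have y0 : 0 < v y by lra.
have grow (b : R) : 0 < b -> exists n, b < v y ^+ n.
  move=> b0.
  pose n := Num.truncn (b / (v y - 1)).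
  have nP : b / (v y - 1) < n.+1%:R by rewrite truncnS_gt.
  exists n.+1.
  have := @bernoulli (v y - 1) n.+1 ltac:(lra).
  have -> : 1 + (v y - 1) = v y by ring.
  move: nP; rewrite ltr_pdivrMr; last lra.
  lra.
(* Negative exponents are avoided by searching for |y|^(m - N). Since s |y|^N > 1, the least m with
   |y|^m > s |y|^N is positive and has a predecessor. *)
have [N NP] := grow (s^-1) ltac:(by rewrite invr_gt0).
have [M MP] := grow (s * v y ^+ N) ltac:(by rewrite mulr_gt0// exprn_gt0).
have ex : exists m, s * v y ^+ N < v y ^+ m by exists M.
have [m mP mmin] := ex_minnP ex.
have yN0 : 0 < v y ^+ N by rewrite exprn_gt0.
exists (y ^+ m / y ^+ N); rewrite absvM absvV !absvX.
rewrite ltr_pdivlMr// mP/= ltr_pdivrMr//.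
case: m mP mmin => [|m] mP mmin.
  rewrite expr0 in mP *.
  have : s^-1 * s < v y ^+ N * s by rewrite ltr_pM2r.
  by rewrite mulVf ?gt_eqF// => h; nra.
rewrite exprS.
have mle : v y ^+ m <= s * v y ^+ N.
  by rewrite leNgt; apply/negP => /mmin; rewrite ltnn.
apply: (@le_lt_trans _ _ (v y * (s * v y ^+ N))).
  by rewrite ler_pM2l.
rewrite mulrA ltr_pM2r//.
by rewrite -ltr_pdivlMr.
Qed.

Hypothesis v_nonarch : nonarchimedean_abs v.

Lemma absvD_max x y : v (x + y) <= Num.max (v x) (v y).
Proof. exact: v_nonarch. Qed.

Lemma absvB_max x y : v (x - y) <= Num.max (v x) (v y).
Proof. by rewrite -(absvN y) v_nonarch. Qed.

Lemma absv_sum_max (I : Type) (s : seq I) (P : pred I) (F : I -> K) (b : R) :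
  0 <= b -> (forall i, P i -> v (F i) <= b) -> v (\sum_(i <- s | P i) F i) <= b.
Proof.
move=> b0 Fb; elim/big_rec : _ => [|i x Pi xb]; first by rewrite absv0.
by rewrite (le_trans (v_nonarch _ _))// ge_max Fb.
Qed.

Lemma absvD_eq x y : v y < v x -> v (x + y) = v x.
Proof.
move=> yx; apply/eqP; rewrite eq_le; apply/andP; split.
  by rewrite (le_trans (v_nonarch _ _))// ge_max lexx ltW.
rewrite leNgt; apply/negP => h.
have := v_nonarch (x + y) (- y); rewrite addrK absvN leNgt gt_max h yx//.
Qed.

Lemma absv_natr n : v n%:R <= 1.
Proof.
elim: n => [|n ih]; first by rewrite absv0.
by rewrite -natr1 (le_trans (v_nonarch _ _))// ge_max ih absv1 lexx.
Qed.

End AbsoluteValue.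

Section Chordal.
Context {R : realType} {K : closedFieldType} (v : absolute_value R K).
Hypothesis v_nonarch : nonarchimedean_abs v.

Let ht (z : option K) := Num.max (v (hcoord z).1) (v (hcoord z).2).
Let cross (z w : option K) :=
  (hcoord z).1 * (hcoord w).2 - (hcoord z).2 * (hcoord w).1.

Let ht_gt0 z : 0 < ht z.
Proof.
by rewrite lt_max !absv_gt0; case: z => [z|]/=; rewrite oner_neq0 ?orbT.
Qed.

Let chordalE z w : chordal v z w = v (cross z w) / (ht z * ht w).
Proof. by []. Qed.

Lemma chordalC z w : chordal v z w = chordal v w z.
Proof.
by rewrite !chordalE (mulrC (ht w)) /cross absvB (mulrC (hcoord w).1) (mulrC (hcoord w).2).
Qed.

Lemma chordal_ge0 z w : 0 <= chordal v z w.
Proof. by rewrite chordalE divr_ge0 ?absv_ge0// mulr_ge0// ltW. Qed.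

Lemma chordal_le1 z w : chordal v z w <= 1.
Proof.
rewrite chordalE ler_pdivrMr ?mulr_gt0// mul1r.
rewrite (le_trans (absvB_max v_nonarch _ _))// ge_max !absvM.
by apply/andP; split; apply: ler_pM; rewrite ?absv_ge0// le_max lexx ?orbT.
Qed.

(** For either coordinate i, cross x z * y_i = cross x y * z_i + cross y z * x_i. The maximum over i
    turns y_i into the height of y. *)
Lemma chordal_ultra x y z :
  chordal v x z <= Num.max (chordal v x y) (chordal v y z).
Proof.
suff H : v (cross x z) * ht y <=
    Num.max (v (cross x y) * ht z) (v (cross y z) * ht x).
  rewrite !chordalE.
  have := ht_gt0 x; have := ht_gt0 y; have := ht_gt0 z => z0 y0 x0.
  have e0 : 0 < ht x * ht y * ht z by rewrite !mulr_gt0.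
  rewrite -(ler_pM2r e0) [X in _ <= X]maxr_pMl; last exact: ltW.
  have -> : v (cross x z) / (ht x * ht z) * (ht x * ht y * ht z) = v (cross x z) * ht y.
    by field; rewrite !gt_eqF.
  have -> : v (cross x y) / (ht x * ht y) * (ht x * ht y * ht z) = v (cross x y) * ht z.
    by field; rewrite !gt_eqF.
  have -> : v (cross y z) / (ht y * ht z) * (ht x * ht y * ht z) = v (cross y z) * ht x.
    by field; rewrite !gt_eqF.
  exact: H.
pose pr (b : bool) (p : K * K) := if b then p.1 else p.2.
have key b : v (cross x z) * v (pr b (hcoord y)) <=
    Num.max (v (cross x y) * ht z) (v (cross y z) * ht x).
  have prht w : v (pr b (hcoord w)) <= ht w.
    by rewrite /ht le_max /pr; case: b; rewrite lexx ?orbT.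
  rewrite -absvM.
  have -> : cross x z * pr b (hcoord y) =
      cross x y * pr b (hcoord z) + cross y z * pr b (hcoord x).
    by rewrite /pr /cross; case: (b); ring.
  rewrite (le_trans (v_nonarch _ _))// !absvM ge_max; apply/andP; split.
    by rewrite le_max ler_wpM2l ?absv_ge0.
  by rewrite le_max ler_wpM2l ?absv_ge0 ?orbT.
rewrite {1}/ht maxr_pMr ?absv_ge0// ge_max; apply/andP; split.
  exact: (key true).
exact: (key false).
Qed.

(** The three-term relation between the 2 x 2 minors of four vectors, combined with the strong
    triangle inequality. With w as base point it yields [hsia_ultra]. *)
Lemma chordal_ptolemy x y z w :
  chordal v x z * chordal v y w <=
  Num.max (chordal v x y * chordal v z w) (chordal v y z * chordal v x w).
Proof.
rewrite !chordalE.
have := ht_gt0 x; have := ht_gt0 y; have := ht_gt0 z; have := ht_gt0 w.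
move=> w0 z0 y0 x0.
have e0 : 0 < ht x * ht y * ht z * ht w by rewrite !mulr_gt0.
rewrite -(ler_pM2r e0) [X in _ <= X]maxr_pMl; last exact: ltW.
set A := (X in X <= _); set B := Num.max _ _.
have -> : A = v (cross x z * cross y w).
  by rewrite absvM /A; field; rewrite !gt_eqF.
have -> : B = Num.max (v (cross x y * cross z w)) (v (cross y z * cross x w)).
  by rewrite !absvM /B; congr Num.max; field; rewrite !gt_eqF.
have -> : cross x z * cross y w =
    cross x y * cross z w + cross y z * cross x w by rewrite /cross; ring.
exact: v_nonarch.
Qed.

End Chordal.

(** * Multiplicative seminorms and density of type I points *)

Section Seminorms.
Context {R : realType} {K : closedFieldType} (v : absolute_value R K).
Hypothesis v_nonarch : nonarchimedean_abs v.
Implicit Types (S : mul_seminorm v) (f : {poly K}).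

Lemma msn_sum S (I : Type) (s : seq I) (F : I -> {poly K}) :
  S (\sum_(i <- s) F i) <= \sum_(i <- s) S (F i).
Proof.
elim: s => [|i s ih]; first by rewrite !big_nil -polyC0 msnC absv0.
by rewrite !big_cons (le_trans (msnD _ _ _))// lerD2l.
Qed.

Lemma msnX S f n : S (f ^+ n) = S f ^+ n.
Proof.
elim: n => [|n ih]; first by rewrite !expr0 -polyC1 msnC absv1.
by rewrite !exprS msnM ih.
Qed.

Lemma msnMn_le S f n : S (f *+ n) <= S f.
Proof.
rewrite -mulr_natl -polyC_natr msnM msnC ler_piMl ?msn_ge0//.
exact: absv_natr.
Qed.

Lemma pow_linear_le (x y : R) : 0 <= x -> 0 <= y ->
  (forall n, x ^+ n <= n.+1%:R * y ^+ n) -> x <= y.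
Proof.
move=> x0 y0 h; rewrite leNgt; apply/negP => yx.
have {}x0 : 0 < x by lra.
have [ye0|yn0] := eqVneq y 0.
  have := h 1%N; rewrite !expr1 ye0; lra.
have {yn0}y0 : 0 < y by rewrite lt_def yn0.
pose e := x / y - 1.
have xy1 : 1 < x / y by rewrite ltr_pdivlMr// mul1r.
have e0 : 0 < e by rewrite /e; lra.
(* (1 + e)^(2n) >= (1 + n e)^2 outgrows 2n + 1 *)
have h2 n : (1 + n%:R * e) ^+ 2 <= (n * 2).+1%:R.
  apply: (@le_trans _ _ ((x / y) ^+ (n * 2))).
    have n0 : (0 : R) <= n%:R by [].
    rewrite exprM; apply: lerXn2r; rewrite ?nnegrE.
    - nra.
    - by apply: exprn_ge0; lra.
    have := @bernoulli R e n ltac:(lra).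
    by have -> : 1 + e = x / y by rewrite /e; ring.
  rewrite expr_div_n ler_pdivrMr ?exprn_gt0//.
pose n := (Num.truncn (2 / (e ^+ 2))).+1.
have nP : 2 / e ^+ 2 < n%:R by rewrite truncnS_gt.
have := h2 n; rewrite -natr1 natrM.
have n1 : (1 : R) <= n%:R by rewrite ler1n.
have : 2 < n%:R * e ^+ 2.
  by move: nP; rewrite ltr_pdivrMr// exprn_gt0.
nra.
Qed.

(** Only subadditivity is built into a seminorm. Binomial coefficients have value at most 1, so the
    n-th power of the left side is at most (n + 1) m^n, and the linear factor is killed by letting n
    grow. *)
Lemma msn_ultra S f h : S (f + h) <= Num.max (S f) (S h).
Proof.
set m := Num.max _ _.
have m0 : 0 <= m by rewrite le_max msn_ge0.
apply: pow_linear_le => // [|n]; first exact: msn_ge0.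
rewrite -msnX exprDn (le_trans (msn_sum _ _ _))//.
rewrite mulr_natl -[n.+1 in leRHS]card_ord -sumr_const ler_sum// => i _.
rewrite (le_trans (msnMn_le _ _ _))// msnM !msnX.
rewrite -[in leRHS](subnK (leq_ord i)) exprD.
by apply: ler_pM; rewrite ?exprn_ge0 ?msn_ge0// lerXn2r ?nnegrE ?msn_ge0// le_max lexx ?orbT.
Qed.

Lemma msnN S f : S (- f) = S f.
Proof. by rewrite -mulN1r -polyCN msnM msnC absvN absv1 mul1r. Qed.

Lemma msn_XsubC_shift S (a b : K) :
  S ('X - b%:P) <= Num.max (S ('X - a%:P)) (v (b - a)).
Proof.
have -> : 'X - b%:P = ('X - a%:P) + (a - b)%:P by rewrite polyCB; ring.
by rewrite (le_trans (msn_ultra _ _ _))// msnC absvB.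
Qed.

Lemma msn_XsubC_eq S (a b : K) : S ('X - a%:P) < v (b - a) ->
  S ('X - b%:P) = v (b - a).
Proof.
move=> h; apply/eqP; rewrite eq_le; apply/andP; split.
  by rewrite (le_trans (msn_XsubC_shift _ a _))// ge_max lexx ltW.
rewrite leNgt; apply/negP => h2.
have : v (b - a) <= Num.max (S ('X - a%:P)) (S ('X - b%:P)).
  rewrite -(msnC S); have -> : (b - a)%:P = ('X - a%:P) + - ('X - b%:P).
    by rewrite polyCB; ring.
  by rewrite (le_trans (msn_ultra _ _ _))// msnN.
by rewrite leNgt gt_max h h2.
Qed.

(** The roots are chosen before [S], so equality and convergence of seminorms can be tested on the
    linear polynomials X - z. *)
Lemma msn_factor f : exists r : seq K, forall S,
  S f = v (lead_coef f) * \prod_(z <- r) S ('X - z%:P).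
Proof.
have [r fE] := closed_field_poly_normal f.
exists r => S; rewrite {1}fE -mul_polyC msnM msnC; congr (_ * _).
elim: r {fE} => [|z r ih]; first by rewrite !big_nil -polyC1 msnC absv1.
by rewrite !big_cons msnM ih.
Qed.

Lemma typeI_seminorm_XsubC (z a : K) :
  typeI_seminorm v z ('X - a%:P) = v (z - a).
Proof. by rewrite /= hornerXsubC. Qed.

Lemma mul_seminorm_ext S S' : (forall f, S f = S' f) -> S = S'.
Proof.
move=> e; have : msn S = msn S' by apply/funext.
case: S {e} => m m0 mC mM mD; case: S' => m' m0' mC' mM' mD' /= e; subst m'.
by congr MulSeminorm; apply: Prop_irrelevance.
Qed.

Lemma mul_seminorm_XsubC_ext S S' :
  (forall a, S ('X - a%:P) = S' ('X - a%:P)) -> S = S'.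
Proof.
move=> e; apply: mul_seminorm_ext => f.
have [r fE] := msn_factor f; rewrite !fE; congr (_ * _).
by apply: eq_bigr => z _; rewrite e.
Qed.

Hypothesis v_nontrivial : nontrivial_abs v.

(** Among the listed centres take [a0] with the smallest value r. Relative to the list, [S] behaves
    like the disk of centre [a0] and radius r, and a point of that disk's edge, slightly enlarged so
    that its radius is a value of K, imitates it. *)
Lemma typeI_approx S (l : seq K) (e : R) : 0 < e ->
  exists z, forall a, a \in l -> `|v (z - a) - S ('X - a%:P)| < e.
Proof.
move=> e0; case: l => [|a1 l]; first by exists 0.
have [a0 a0l a0min] : exists2 a0, a0 \in a1 :: l &
    forall a, a \in a1 :: l -> S ('X - a0%:P) <= S ('X - a%:P).
  elim: l a1 => [|a2 l ih] a1.
    by exists a1; rewrite ?mem_head// => a; rewrite inE => /eqP ->.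
  have [a0 a0l a0min] := ih a2.
  have [h|h] := leP (S ('X - a0%:P)) (S ('X - a1%:P)).
    exists a0; first by rewrite inE a0l orbT.
    by move=> a; rewrite inE => /orP[/eqP ->//|/a0min].
  exists a1; first by rewrite mem_head.
  move=> a; rewrite inE => /orP[/eqP ->//|/a0min].
  by apply: le_trans; exact: ltW.
set r := S ('X - a0%:P) in a0min.
(* With r < |w| < r', the point [a0 + w] is at distance |a - a0| from those a with |a - a0| > r, and
   at distance |w|, within e of r, from all others. *)
have [r' [rr' r'e r'P]] : exists r', [/\ r < r', r' <= r + e &
    forall a, a \in a1 :: l -> r < v (a - a0) -> r' <= v (a - a0)].
  elim: (a1 :: l) => [|a2 l' [r' [rr' r'e ih]]].
    by exists (r + e); split => //; lra.
  have [h|h] := ltP r (v (a2 - a0)).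
    exists (Num.min r' (v (a2 - a0))); split; first by rewrite lt_min rr'.
      by rewrite ge_min r'e.
    move=> a; rewrite inE ge_min => /orP[/eqP -> _|al ra]; first by rewrite lexx orbT.
    by rewrite ih.
  exists r'; split => // a; rewrite inE => /orP[/eqP ->|]; last exact: ih.
  by rewrite ltNge h.
have r0 : 0 <= r by exact: msn_ge0.
have [w /andP[rw wr']] := absv_between v_nontrivial r0 rr'.
exists (a0 + w) => a al.
have -> : a0 + w - a = w - (a - a0) by ring.
have [h|h] := ltP r (v (a - a0)).
  rewrite (@msn_XsubC_eq _ a0)// absvB absvD_eq// ?absvN ?subrr ?normr0//.
  exact: lt_le_trans wr' (r'P _ al h).
rewrite absvD_eq// ?absvN; last exact: le_lt_trans rw.
have -> : S ('X - a%:P) = r.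
  apply/eqP; rewrite eq_le a0min// andbT.
  by rewrite (le_trans (msn_XsubC_shift _ a0 _))// ge_max lexx.
rewrite ger0_norm; lra.
Qed.

End Seminorms.

Section Topology.
Context {R : realType} {K : closedFieldType} (v : absolute_value R K).

Lemma msn_continuous (f : {poly K}) : continuous (fun S : berkA1 v => msn S f).
Proof.
move=> S.
apply: (@continuous_comp _ {ptws {poly K} -> R} _ (@msn _ _ v : berkA1 v -> _) (fun h => h f)).
  exact: initial_continuous.
exact: proj_continuous.
Qed.

Lemma berkA1_cvg (F : set_system (berkA1 v)) (S : berkA1 v) : Filter F ->
  (forall f, (fun T : berkA1 v => msn T f) @ F --> msn S f) -> F --> S.
Proof.
move=> FF h.
have : (@msn _ _ v : berkA1 v -> {ptws {poly K} -> R}) @ F -->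
    (msn S : {ptws {poly K} -> R}).
  apply/cvg_sup => f U [/= B [[W oW <-]] /= WS /filterS]; apply.
  by apply: (h f); apply: open_nbhs_nbhs.
move=> {}h U [/= B [[W oW <-]] /= WS /filterS]; apply.
by apply: h; apply: open_nbhs_nbhs.
Qed.

Hypothesis v_nonarch : nonarchimedean_abs v.
Hypothesis v_nontrivial : nontrivial_abs v.

(** The type I approximants of [S] on a finite list of centres and up to a tolerance form a filter
    base. Convergence on linear factors passes to every polynomial by factorisation. *)
Lemma typeI_dense_berkA1 (A : set (berkA1 v)) : closed A ->
  (forall z : K, A (typeI_seminorm v z)) -> forall S, A S.
Proof.
move=> cA AI S.
pose B (p : seq K * R) := [set T : berkA1 v | exists2 z,
  T = typeI_seminorm v z &
  forall a, a \in p.1 -> `|v (z - a) - S ('X - a%:P)| < p.2].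
pose F := filter_from [set p : seq K * R | 0 < p.2] B.
have FF : ProperFilter F.
  apply: filter_from_proper.
    apply: filter_from_filter; first by exists ([::], 1) => /=.
    move=> [l1 e1] [l2 e2] /= e10 e20; exists (l1 ++ l2, Num.min e1 e2) => /=.
      by rewrite lt_min e10.
    move=> _ [z -> zP]; split; exists z => // a al; have /= := zP a;
      by rewrite mem_cat al ?orbT lt_min => /(_ isT)/andP[].
  move=> [l e] /= e0; have [z zP] := typeI_approx v_nonarch v_nontrivial S l e0.
  by exists (typeI_seminorm v z); exists z.
have FS : F --> S.
  apply: berkA1_cvg => f.
  have [r fE] := msn_factor v f.
  under [X in X @ F]eq_fun do rewrite fE.
  rewrite fE; apply: cvgM; first exact: cvg_cst.
  elim: r {fE} => [|a r ih].
    under [X in X @ F]eq_fun do rewrite big_nil.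
    by rewrite big_nil; exact: cvg_cst.
  under [X in X @ F]eq_fun do rewrite big_cons.
  rewrite big_cons; apply: cvgM => //.
  apply/cvgrPdist_lt => e e0.
  exists ([:: a], e) => // _ [z -> /= zP].
  by rewrite hornerXsubC distrC zP// mem_head.
apply: (@closed_cvg _ _ F FF id A cA _ _ FS).
by exists ([::], 1); rewrite /= ?ltr01// => _ [z -> _]; exact: AI.
Qed.

Lemma typeI_dense (A : set (berkP1 v)) : closed A ->
  (forall z, A (typeI v z)) -> forall x, A x.
Proof.
move=> cA AI [S|]; last exact: (AI None).
apply: (@typeI_dense_berkA1 (Some @^-1` A)) => [|z]; last exact: (AI (Some z)).
apply: closed_comp cA => ? _.
exact: one_point_compactification_some_continuous.
Qed.

End Topology.

(** * The extended chordal kernel *)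

Lemma closed_le_continuous (R : realType) (T : topologicalType) (F G : T -> R) :
  continuous F -> continuous G -> closed [set x | F x <= G x].
Proof.
move=> cF cG.
have -> : [set x | F x <= G x] = (fun x => G x - F x) @^-1` [set y | 0 <= y].
  by apply/seteqP; split => x /=; rewrite subr_ge0.
apply: closed_comp; last exact: closed_ge.
by move=> x _; apply: continuousB; [exact: cG|exact: cF].
Qed.

Lemma closed_eq_continuous (R : realType) (T : topologicalType) (F G : T -> R) :
  continuous F -> continuous G -> closed [set x | F x = G x].
Proof.
move=> cF cG.
have -> : [set x | F x = G x] = [set x | F x <= G x] `&` [set x | G x <= F x].
  apply/seteqP; split => [x /= ->|x /= [a b]] //.
  by apply/eqP; rewrite eq_le a.
by apply: closedI; apply: closed_le_continuous.
Qed.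

Lemma continuous_mul_fun (R : realType) (T : topologicalType) (F G : T -> R) :
  continuous F -> continuous G -> continuous (fun x => F x * G x).
Proof. by move=> cF cG x; apply: continuousM; [exact: cF|exact: cG]. Qed.

Lemma continuous_max_fun (R : realType) (T : topologicalType) (F G : T -> R) :
  continuous F -> continuous G -> continuous (fun x => Num.max (F x) (G x)).
Proof. by move=> cF cG x; apply: continuous_max; [exact: cF|exact: cG]. Qed.

Section Kernel.
Context {R : realType} {K : closedFieldType} (v : absolute_value R K).
Hypothesis v_nonarch : nonarchimedean_abs v.
Hypothesis v_nontrivial : nontrivial_abs v.
Local Notation g := (@chordal_kernel R K v).
Hypothesis gE : chordal_extension g.
Local Notation P1 := (berkP1 v).

Lemma ker_typeI z w : g (typeI v z) (typeI v w) = chordal v z w.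
Proof. by case: gE. Qed.

Lemma ker_typeI_self b : g (typeI v b) (typeI v b) = 0.
Proof.
rewrite ker_typeI /chordal (_ : _ - _ = 0) ?absv0 ?mul0r//.
by rewrite mulrC subrr.
Qed.

Lemma ker_continuousr x : continuous (g x).
Proof. by case: gE. Qed.

Lemma ker_continuousl y : continuous (g^~ y).
Proof. by case: gE. Qed.

Let dense := typeI_dense v_nonarch v_nontrivial.

(** Joint continuity fails on the diagonal, so an identity is extended from type I points one
    variable at a time, each variable occurring once in every kernel. The same scheme serves for the
    inequalities that follow. *)
Lemma kerC x y : g x y = g y x.
Proof.
move: x y; have H z y : g (typeI v z) y = g y (typeI v z).
  apply: (dense (A := [set y | g (typeI v z) y = g y (typeI v z)])).
    by apply: closed_eq_continuous; [exact: ker_continuousr|exact: ker_continuousl].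
  by move=> w /=; rewrite !ker_typeI chordalC.
move=> x y; apply: (dense (A := [set x | g x y = g y x])).
  by apply: closed_eq_continuous; [exact: ker_continuousl|exact: ker_continuousr].
by move=> w /=.
Qed.

Lemma ker_ge0 x y : 0 <= g x y.
Proof.
apply: (dense (A := [set x | 0 <= g x y])).
  by apply: closed_le_continuous; [exact: cst_continuous|exact: ker_continuousl].
move=> z /=.
apply: (dense (A := [set y | 0 <= g (typeI v z) y])).
  by apply: closed_le_continuous; [exact: cst_continuous|exact: ker_continuousr].
by move=> w /=; rewrite ker_typeI chordal_ge0.
Qed.

Lemma ker_le1 x y : g x y <= 1.
Proof.
apply: (dense (A := [set x | g x y <= 1])).
  by apply: closed_le_continuous; [exact: ker_continuousl|exact: cst_continuous].
move=> z /=.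
apply: (dense (A := [set y | g (typeI v z) y <= 1])).
  by apply: closed_le_continuous; [exact: ker_continuousr|exact: cst_continuous].
by move=> w /=; rewrite ker_typeI chordal_le1.
Qed.

Lemma ker_ultra y x z : g x z <= Num.max (g x y) (g y z).
Proof.
apply: (dense (A := [set x | g x z <= Num.max (g x y) (g y z)])).
  apply: closed_le_continuous; first exact: ker_continuousl.
  by apply: continuous_max_fun; [exact: ker_continuousl|exact: cst_continuous].
move=> {}x /=.
apply: (dense (A := [set z | g (typeI v x) z <= Num.max (g (typeI v x) y) (g y z)])).
  apply: closed_le_continuous; first exact: ker_continuousr.
  by apply: continuous_max_fun; [exact: cst_continuous|exact: ker_continuousr].
move=> {}z /=.
apply: (dense (A := [set y | g (typeI v x) (typeI v z) <=
    Num.max (g (typeI v x) y) (g y (typeI v z))])).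
  apply: closed_le_continuous; first exact: cst_continuous.
  by apply: continuous_max_fun; [exact: ker_continuousr|exact: ker_continuousl].
by move=> {}y /=; rewrite !ker_typeI chordal_ultra.
Qed.

Lemma ker_ptolemy x y z w :
  g x z * g y w <= Num.max (g x y * g z w) (g y z * g x w).
Proof.
apply: (dense (A := [set x | g x z * g y w <=
    Num.max (g x y * g z w) (g y z * g x w)])).
  apply: closed_le_continuous; [|apply: continuous_max_fun]; apply: continuous_mul_fun;
    (exact: cst_continuous || exact: ker_continuousl).
move=> {}x /=.
apply: (dense (A := [set z | g (typeI v x) z * g y w <=
    Num.max (g (typeI v x) y * g z w) (g y z * g (typeI v x) w)])).
  apply: closed_le_continuous; [|apply: continuous_max_fun]; apply: continuous_mul_fun;
    (exact: cst_continuous || exact: ker_continuousl || exact: ker_continuousr).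
move=> {}z /=.
apply: (dense (A := [set y | g (typeI v x) (typeI v z) * g y w <=
    Num.max (g (typeI v x) y * g (typeI v z) w)
            (g y (typeI v z) * g (typeI v x) w)])).
  apply: closed_le_continuous; [|apply: continuous_max_fun]; apply: continuous_mul_fun;
    (exact: cst_continuous || exact: ker_continuousl || exact: ker_continuousr).
move=> {}y /=.
apply: (dense (A := [set w | g (typeI v x) (typeI v z) * g (typeI v y) w <=
    Num.max (g (typeI v x) (typeI v y) * g (typeI v z) w)
            (g (typeI v y) (typeI v z) * g (typeI v x) w)])).
  apply: closed_le_continuous; [|apply: continuous_max_fun]; apply: continuous_mul_fun;
    (exact: cst_continuous || exact: ker_continuousl || exact: ker_continuousr).
by move=> {}w /=; rewrite !ker_typeI chordal_ptolemy.
Qed.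

Lemma ker_isosceles x y z : g x y < g y z -> g x z = g y z.
Proof.
move=> h; apply/eqP; rewrite eq_le; apply/andP; split.
  by rewrite (le_trans (ker_ultra y _ _))// ge_max lexx ltW.
have := ker_ultra x y z; rewrite le_max (kerC y x) => /orP[|//].
by rewrite leNgt h.
Qed.

Let some_continuous (F : P1 -> R) : continuous F ->
  continuous (fun S : berkA1 v => F (Some S)).
Proof.
move=> cF S; apply: (@continuous_comp (berkA1 v) P1 R (@Some _ : berkA1 v -> P1) F S); last exact: cF.
exact: one_point_compactification_some_continuous.
Qed.

Lemma ker_infty (S : berkA1 v) :
  g (Some S) (binfty v) * Num.max 1 (msn S 'X) = 1.
Proof.
apply: (typeI_dense_berkA1 v_nonarch v_nontrivial
  (A := [set S | g (Some S) (binfty v) * Num.max 1 (msn S 'X) = 1])).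
  apply: closed_eq_continuous; last exact: cst_continuous.
  apply: continuous_mul_fun; first by apply: (some_continuous (F := g^~ _)); exact: ker_continuousl.
  by apply: continuous_max_fun; [exact: cst_continuous|exact: msn_continuous].
move=> z /=; rewrite (ker_typeI (Some z) None) /chordal /=.
rewrite hornerX mulr0 sub0r mulr1 absvN absv1 absv0 (maxC (v z)) (max_l (@ler01 R)) mulr1.
by rewrite div1r mulVf// gt_eqF// lt_max ltr01.
Qed.

Lemma ker_infty_gt0 (S : berkA1 v) : 0 < g (Some S) (binfty v).
Proof.
rewrite lt_def ker_ge0 andbT; apply/eqP => h.
have := ker_infty S; rewrite h mul0r => /eqP.
by rewrite eq_sym oner_eq0.
Qed.

Lemma ker_XsubC (S : berkA1 v) (b : K) :
  g (Some S) (typeI v (Some b)) =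
  msn S ('X - b%:P) * (g (Some S) (binfty v) * g (typeI v (Some b)) (binfty v)).
Proof.
apply: (typeI_dense_berkA1 v_nonarch v_nontrivial
  (A := [set S | g (Some S) (typeI v (Some b)) =
  msn S ('X - b%:P) * (g (Some S) (binfty v) * g (typeI v (Some b)) (binfty v))])).
  apply: closed_eq_continuous.
    by apply: (some_continuous (F := g^~ _)); exact: ker_continuousl.
  apply: continuous_mul_fun; first exact: msn_continuous.
  apply: continuous_mul_fun; last exact: cst_continuous.
  by apply: (some_continuous (F := g^~ _)); exact: ker_continuousl.
move=> z /=; rewrite (ker_typeI (Some z) None) (ker_typeI (Some z) (Some b)).
rewrite (ker_typeI (Some b) None) /chordal /= hornerXsubC.
rewrite !mulr0 !sub0r !mulr1 !mul1r !absvN !absv1 !absv0 (max_l (@ler01 R)) !mulr1.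
by rewrite !div1r invfM.
Qed.

(** The value at oo gives [g x oo], which is positive off oo; dividing by it in [ker_XsubC] recovers
    the seminorm on linear polynomials. *)
Lemma ker_separates (x y : P1) :
  (forall b, g x (typeI v b) = g y (typeI v b)) -> x = y.
Proof.
have aux (S : berkA1 v) : ~ (forall b, g (Some S) (typeI v b) = g None (typeI v b)).
  move=> /(_ None) h; have := ker_infty_gt0 S.
  rewrite -[binfty v]/(typeI v None) h (ker_typeI None None) /chordal/=.
  by rewrite mulr0 mul0r subrr absv0 mul0r ltxx.
case: x => [S|]; case: y => [S'|] h //.
- congr Some; apply: mul_seminorm_XsubC_ext => b.
  have := h (Some b); rewrite !ker_XsubC.
  have -> : g (Some S') (binfty v) = g (Some S) (binfty v) by rewrite -(h None).
  apply: mulIf; rewrite mulf_neq0// gt_eqF// ker_infty_gt0//.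
- by exfalso; apply: (aux S).
- by exfalso; apply: (aux S') => b; rewrite h.
Qed.

(** By the ultrametric inequality, points at distance zero have the same distance to every third
    point. The converse fails: [g x x] may be positive away from type I. *)
Lemma ker_eq0 x y : g x y = 0 -> x = y.
Proof.
have le z x' y' : g x' y' = 0 -> g x' z <= g y' z.
  move=> h; have := ker_ultra y' x' z.
  by rewrite h max_r ?ker_ge0.
move=> h; apply: ker_separates => b; apply/eqP.
by rewrite eq_le !le// kerC.
Qed.

Lemma ker_gt0 x y : x <> y -> 0 < g x y.
Proof.
move=> xy; rewrite lt_def ker_ge0 andbT; apply/eqP => /ker_eq0; exact: xy.
Qed.

(** The functions [g^~ (typeI v b)] are continuous, real-valued and separate points. *)
Lemma berkP1_hausdorff : hausdorff_space P1.
Proof.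
move=> x y xy; apply: ker_separates => b.
apply: (@Rhausdorff R) => A B xA yB.
have [z [zA zB]] := xy (g^~ (typeI v b) @^-1` A) (g^~ (typeI v b) @^-1` B)
  (ker_continuousl xA) (ker_continuousl yB).
by exists (g z (typeI v b)).
Qed.

Lemma hsiaE S0 x y : 0 < g x S0 -> 0 < g y S0 ->
  hsia S0 x y = (g x y / (g x S0 * g y S0))%:E.
Proof. by move=> x0 y0; rewrite /hsia mulf_eq0 !gt_eqF. Qed.

(** If the norm were d < r, some w with d < |w| < r would make both a and a + w lie in the disk,
    although their difference has value above d. *)
Lemma le_disk_norm_XsubC (a b : K) (r : R) : 0 <= r ->
  r <= disk_norm v (Kdisk v a r) ('X - b%:P).
Proof.
move=> r0; rewrite leNgt; apply/negP => h.
have ub : has_ubound [set v ('X - b%:P).[z] | z in Kdisk v a r].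
  exists (Num.max r (v (a - b))) => _ [z /= zr <-].
  rewrite hornerXsubC (_ : z - b = (z - a) + (a - b)); last by ring.
  by rewrite (le_trans (absvD_max v_nonarch _ _))// ge_max !le_max zr lexx orbT.
have d0 : 0 <= disk_norm v (Kdisk v a r) ('X - b%:P).
  apply: (@le_trans _ _ (v (a - b))); first exact: absv_ge0.
  apply: ub_le_sup => //; exists a; last by rewrite hornerXsubC.
  by rewrite /Kdisk /= subrr absv0.
have [w /andP[w1 w2]] := absv_between v_nontrivial d0 h.
have le z : Kdisk v a r z -> v (z - b) <= disk_norm v (Kdisk v a r) ('X - b%:P).
  by move=> zr; apply: ub_le_sup => //; exists z => //; rewrite hornerXsubC.
have : v w <= disk_norm v (Kdisk v a r) ('X - b%:P).
  rewrite (_ : w = (a + w - b) - (a - b)); last by ring.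
  rewrite (le_trans (absvB_max v_nonarch _ _))// ge_max !le//=.
    by rewrite /Kdisk /= subrr absv0.
  by rewrite /Kdisk /= addrC addKr ltW.
by rewrite leNgt w1.
Qed.

(** [diam] is a chosen radius. The bound holds for every admissible radius of either kind, and for
    the default 0, so it does not matter which one was chosen. *)
Lemma diam_le_XsubC (S : berkA1 v) (b : K) :
  (diam (Some S : P1) <= (msn S ('X - b%:P))%:E)%E.
Proof.
rewrite /diam lee_fin.
case: xgetP => [d _ [|]|_]; last exact: msn_ge0.
- by case=> a [d0 ->]; exact: le_disk_norm_XsubC.
- case=> a [r [r0 _ _ rS rd]].
  apply: (@ler_cvg_to _ _ _ _ _ _ _ _ rd (rS _)).
  by near=> n; exact: le_disk_norm_XsubC.
Unshelve. all: by end_near. Qed.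

Lemma diam_le_hsia (x : P1) : x <> binfty v -> (diam x <= hsia (binfty v) x x)%E.
Proof.
case: x => [S _|//].
have S0 := ker_infty_gt0 S.
rewrite hsiaE//.
have [d dE] : exists d, diam (Some S : P1) = d%:E by eexists.
rewrite dE lee_fin ler_pdivlMr ?mulr_gt0// mulrA.
(* For type I points y this is [diam_le_XsubC] with denominators cleared. The condition is closed in
   y alone, so density gives it at y = [Some S], on the diagonal. *)
apply: (dense (A := [set y | d * g (Some S) (binfty v) * g y (binfty v) <= g (Some S) y])).
  apply: closed_le_continuous; last exact: ker_continuousr.
  by apply: continuous_mul_fun; [exact: cst_continuous|exact: ker_continuousl].
move=> [b|] /=.
  rewrite (ker_XsubC S b) -mulrA ler_pM2r ?mulr_gt0 ?ker_infty_gt0//.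
  by rewrite -lee_fin -dE diam_le_XsubC.
by rewrite (ker_typeI None None) /chordal /= mulr0 mul0r subrr absv0 mul0r mulr0 ker_ge0.
Qed.

End Kernel.

(** * Gauss points and connectedness of balls *)

Lemma connected_between (T : topologicalType) (A B : set T) :
  connected A -> A `<=` B -> B `<=` closure A -> connected B.
Proof.
move=> cA AB BcA B0 [b B0b] [C oC BC] [D cD BD].
have Bb : B b by move: B0b; rewrite BC => -[].
have Cb : C b by move: B0b; rewrite BC => -[].
have AE : A `&` C = A.
  apply: cA.
  - have [z [Az Cz]] := BcA b Bb C (open_nbhs_nbhs (conj oC Cb)).
    by exists z.
  - by exists C.
  - exists D => //; apply/seteqP; split => z [Az] zP; split => //.
      have : (B `&` C) z by split => //; exact: AB.
      by rewrite -BC BD => -[].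
    have : (B `&` D) z by split => //; exact: AB.
    by rewrite -BD BC => -[].
have AD : A `<=` D.
  move=> z Az; have : (B `&` C) z by split; [exact: AB|move: Az; rewrite -AE => -[]].
  by rewrite -BC BD => -[].
rewrite BD; apply: setIidl => z Bz.
have : closure D z by apply: closureS AD _ (BcA _ Bz).
by rewrite -((closure_id D).1 cD).
Qed.

Lemma compact_pos_lbound (R : realType) (T : topologicalType) (A : set T)
    (f : T -> R) : continuous f -> compact A -> (forall x, A x -> 0 < f x) ->
  exists2 e, 0 < e & forall x, A x -> e <= f x.
Proof.
move=> cf cA f0.
have cfA : closed (f @` A).
  apply: compact_closed; first exact: Rhausdorff.
  by apply: continuous_compact => //; exact: continuous_subspaceT.
have n0 : (~` (f @` A)) 0 by move=> -[x /f0 + fx]; rewrite fx ltxx.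
have : nbhs (0 : R) (~` (f @` A)).
  by apply: open_nbhs_nbhs; split => //; exact: closed_openC.
move=> /nbhs_ballP[e /= e0 eA]; exists e => // x Ax.
rewrite leNgt; apply/negP => fe; apply: (eA (f x)); last by exists x.
by rewrite -ball_normE /= sub0r normrN gtr0_norm// f0.
Qed.

Section GaussNorm.
Context {R : realType} {K : closedFieldType} (v : absolute_value R K).
Hypothesis v_nonarch : nonarchimedean_abs v.
Variable t : R.
Hypothesis t0 : 0 <= t.
Implicit Types f h : {poly K}.

Definition gauss_norm f : R := \big[Num.max/0]_(i < size f) (v f`_i * t ^+ i).

Let term_ge0 f i : 0 <= v f`_i * t ^+ i.
Proof. by rewrite mulr_ge0 ?absv_ge0// exprn_ge0. Qed.

Lemma gauss_norm_ge0 f : 0 <= gauss_norm f.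
Proof. by rewrite /gauss_norm; elim/big_rec : _ => // i x _ x0; rewrite le_max x0 orbT. Qed.

Lemma gauss_norm_ge f i : v f`_i * t ^+ i <= gauss_norm f.
Proof.
have [il|il] := ltnP i (size f); last first.
  by rewrite nth_default// absv0 mul0r gauss_norm_ge0.
exact: (@le_bigmax _ _ _ 0 (fun i : 'I_(size f) => v f`_i * t ^+ i) (Ordinal il)).
Qed.

Lemma gauss_norm_le f b : 0 <= b -> (forall i, v f`_i * t ^+ i <= b) ->
  gauss_norm f <= b.
Proof. by move=> b0 fb; apply: bigmax_le => // i _. Qed.

Lemma gauss_norm_attained f : exists i, v f`_i * t ^+ i == gauss_norm f.
Proof.
apply/not_existsP => h.
have [g0|g0] := eqVneq (gauss_norm f) 0.
  apply: (h (size f)); rewrite nth_default// absv0 mul0r g0 eqxx//.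
suff : gauss_norm f < gauss_norm f by rewrite ltxx.
rewrite {1}/gauss_norm; apply: bigmax_lt.
  by rewrite lt_def g0 gauss_norm_ge0.
by move=> i _; rewrite lt_neqAle gauss_norm_ge andbT; apply/negP/h.
Qed.

Lemma gauss_normC c : gauss_norm c%:P = v c.
Proof.
apply/eqP; rewrite eq_le; apply/andP; split.
  apply: gauss_norm_le => [|i]; first exact: absv_ge0.
  by rewrite coefC; case: i => [|i] /=; rewrite ?expr0 ?mulr1// absv0 mul0r absv_ge0.
by apply: le_trans (gauss_norm_ge _ 0); rewrite coefC expr0 mulr1.
Qed.

Lemma gauss_normD f h : gauss_norm (f + h) <= gauss_norm f + gauss_norm h.
Proof.
apply: gauss_norm_le => [|i]; first by rewrite addr_ge0 ?gauss_norm_ge0.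
rewrite coefD (@le_trans _ _ ((v f`_i + v h`_i) * t ^+ i))//.
  by rewrite ler_wpM2r ?exprn_ge0// absvD.
by rewrite mulrDl lerD// gauss_norm_ge.
Qed.

Let absv_sum_lt (I : Type) (s : seq I) (P : pred I) (F : I -> K) (b : R) :
  0 < b -> (forall i, P i -> v (F i) < b) -> v (\sum_(i <- s | P i) F i) < b.
Proof.
move=> b0 Fb; elim/big_rec : _ => [|i x Pi xb]; first by rewrite absv0.
by rewrite (le_lt_trans (v_nonarch _ _))// gt_max Fb.
Qed.

(* Gauss's lemma: in the product, the coefficient at the sum of the least
   indices where the two maxima are attained has a strictly dominant term. *)
Lemma gauss_normM f h : gauss_norm (f * h) = gauss_norm f * gauss_norm h.
Proof.
have mul_le i j : v (f`_i * h`_j) * t ^+ (i + j) <= gauss_norm f * gauss_norm h.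
  rewrite absvM exprD mulrACA; apply: ler_pM => //; exact: gauss_norm_ge.
apply/eqP; rewrite eq_le; apply/andP; split.
  have gg0 : 0 <= gauss_norm f * gauss_norm h by rewrite mulr_ge0 ?gauss_norm_ge0.
  apply: gauss_norm_le => // k.
  have [tk0|tk0] := eqVneq (t ^+ k) 0; first by rewrite tk0 mulr0.
  have {}tk0 : 0 < t ^+ k by rewrite lt_def tk0 exprn_ge0.
  rewrite -ler_pdivlMr// coefM; apply: (absv_sum_max v_nonarch).
    by rewrite divr_ge0// ltW.
  move=> i _; rewrite ler_pdivlMr//.
  by have := mul_le i (k - i)%N; rewrite subnKC// -ltnS.
have [f0|f0] := eqVneq (gauss_norm f) 0; first by rewrite f0 mul0r gauss_norm_ge0.
have [h0|h0] := eqVneq (gauss_norm h) 0; first by rewrite h0 mulr0 gauss_norm_ge0.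
have {}f0 : 0 < gauss_norm f by rewrite lt_def f0 gauss_norm_ge0.
have {}h0 : 0 < gauss_norm h by rewrite lt_def h0 gauss_norm_ge0.
have [i /eqP iE imin] := ex_minnP (gauss_norm_attained f).
have [j /eqP jE jmin] := ex_minnP (gauss_norm_attained h).
have lti k : (k < i)%N -> v f`_k * t ^+ k < gauss_norm f.
  move=> ki; rewrite lt_neqAle gauss_norm_ge andbT; apply/negP => /imin.
  by rewrite leqNgt ki.
have ltj k : (k < j)%N -> v h`_k * t ^+ k < gauss_norm h.
  move=> kj; rewrite lt_neqAle gauss_norm_ge andbT; apply/negP => /jmin.
  by rewrite leqNgt kj.
have mainE : v (f`_i * h`_j) * t ^+ (i + j) = gauss_norm f * gauss_norm h.
  by rewrite absvM exprD mulrACA iE jE.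
have tij : 0 < t ^+ (i + j).
  rewrite lt_def exprn_ge0// andbT; apply/eqP => e.
  by move: mainE; rewrite e mulr0 => /eqP; rewrite eq_sym mulf_eq0 !gt_eqF.
have main0 : 0 < v (f`_i * h`_j).
  by rewrite -(pmulr_lgt0 _ tij) mainE mulr_gt0.
apply: le_trans (gauss_norm_ge _ (i + j)); rewrite -mainE.
apply: ler_wpM2r; first exact: ltW.
have iij : (i < (i + j).+1)%N by rewrite ltnS leq_addr.
rewrite coefM (bigD1 (Ordinal iij))//= addKn absvD_eq//.
apply: absv_sum_lt => // k kne.
rewrite -(ltr_pM2r tij) mainE.
have kij : (k <= i + j)%N by rewrite -ltnS.
have -> : t ^+ (i + j) = t ^+ k * t ^+ (i + j - k) by rewrite -exprD subnKC.
rewrite absvM mulrACA.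
have [ki|ik] := ltnP k i.
  apply: (@le_lt_trans _ _ (v f`_k * t ^+ k * gauss_norm h)).
    by rewrite ler_wpM2l// gauss_norm_ge.
  by rewrite ltr_pM2r// lti.
have {}ik : (i < k)%N.
  rewrite ltn_neqAle ik andbT; apply: contraNneq kne => ik'.
  by apply/eqP/val_inj.
apply: (@le_lt_trans _ _ (gauss_norm f * (v h`_(i + j - k) * t ^+ (i + j - k)))).
  by rewrite ler_wpM2r// gauss_norm_ge.
by rewrite ltr_pM2l// ltj// ltn_subLR// ltn_add2r.
Qed.

Lemma gauss_norm_XaddC c : gauss_norm ('X + c%:P) = Num.max (v c) t.
Proof.
apply/eqP; rewrite eq_le; apply/andP; split.
  apply: gauss_norm_le => [|i]; first by rewrite le_max t0 orbT.
  rewrite coefD coefX coefC; case: i => [|[|i]] /=.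
  - by rewrite expr0 mulr1 add0r le_max lexx.
  - by rewrite addr0 absv1 mul1r expr1 le_max lexx orbT.
  - by rewrite addr0 absv0 mul0r le_max t0 orbT.
rewrite ge_max; apply/andP; split.
  by apply: le_trans (gauss_norm_ge _ 0); rewrite coefD coefX coefC /= add0r expr0 mulr1.
by apply: le_trans (gauss_norm_ge _ 1); rewrite coefD coefX coefC /= addr0 absv1 mul1r.
Qed.

End GaussNorm.

Section GaussPoint.
Context {R : realType} {K : closedFieldType} (v : absolute_value R K).
Hypothesis v_nonarch : nonarchimedean_abs v.
Variables (b : K) (t : R).

(** Composition with X + b moves the centre to 0. Using [|t|] as radius defines the family for all
    real t, so that paths are continuous on the whole line. *)
Let nf (f : {poly K}) : R := gauss_norm v `|t| (f \Po ('X + b%:P)).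

Let nf_ge0 f : 0 <= nf f. Proof. exact: gauss_norm_ge0. Qed.

Let nfC c : nf c%:P = v c.
Proof. by rewrite /nf comp_polyC gauss_normC. Qed.

Let nfM f h : nf (f * h) = nf f * nf h.
Proof. by rewrite /nf comp_polyM gauss_normM. Qed.

Let nfD f h : nf (f + h) <= nf f + nf h.
Proof. by rewrite /nf comp_polyD gauss_normD. Qed.

(* The type I, II or III point of the disk of centre b and radius |t|. *)
Definition gauss_point : berkA1 v := MulSeminorm nf_ge0 nfC nfM nfD.

Lemma gauss_point_XsubC a :
  msn gauss_point ('X - a%:P) = Num.max (v (b - a)) `|t|.
Proof.
rewrite /= /nf comp_polyB comp_polyX comp_polyC -addrA -polyCB.
by rewrite gauss_norm_XaddC.
Qed.

End GaussPoint.

Section Connected.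
Context {R : realType} {K : closedFieldType} (v : absolute_value R K).
Hypothesis v_nonarch : nonarchimedean_abs v.
Hypothesis v_nontrivial : nontrivial_abs v.
Local Notation g := (@chordal_kernel R K v).
Hypothesis gE : chordal_extension g.
Local Notation P1 := (berkP1 v).
Local Notation gp := (gauss_point v_nonarch).

Definition gauss_path (b : K) (t : R) : P1 := Some (gp b t).

Lemma gauss_path_continuous b : continuous (gauss_path b).
Proof.
move=> t; apply: (@continuous_comp R (berkA1 v) P1 (gp b) (@Some _ : berkA1 v -> P1)); last first.
  exact: one_point_compactification_some_continuous.
apply: berkA1_cvg => f.
have [r fE] := msn_factor v f.
under [X in X @ _]eq_fun do rewrite fE.
rewrite fE; apply: cvgM; first exact: cvg_cst.
elim: r {fE} => [|a r ih].
  under [X in X @ _]eq_fun do rewrite big_nil.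
  by rewrite big_nil; exact: cvg_cst.
under [X in X @ _]eq_fun do rewrite big_cons.
rewrite big_cons; apply: cvgM => //.
change ((fun x => msn (gp b x) ('X - a%:P)) @ t --> msn (gp b t) ('X - a%:P)).
under [X in X @ _]eq_fun do rewrite gauss_point_XsubC.
rewrite gauss_point_XsubC.
by apply: continuous_max; [exact: cvg_cst|exact: norm_continuous].
Qed.

Lemma gauss_path_connected b (I : set R) : is_interval I ->
  connected (gauss_path b @` I).
Proof.
move=> /connected_intervalP cI.
apply: connected_continuous_connected => //.
by apply: continuous_subspaceT; exact: gauss_path_continuous.
Qed.

Lemma gauss_path0 b : gauss_path b 0 = typeI v (Some b).
Proof.
congr Some; apply: mul_seminorm_XsubC_ext => a.
by rewrite gauss_point_XsubC normr0 typeI_seminorm_XsubC max_l// absv_ge0.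
Qed.

Lemma gauss_path_eq a b : gauss_path a (v (a - b)) = gauss_path b (v (a - b)).
Proof.
congr Some; apply: mul_seminorm_XsubC_ext => c.
rewrite !gauss_point_XsubC ger0_norm ?absv_ge0//.
apply/eqP; rewrite eq_le !ge_max !le_max !lexx !orbT !andbT.
apply/andP; split.
  rewrite (_ : a - c = (b - c) + (a - b)); last by ring.
  by have := absvD_max v_nonarch (b - c) (a - b); rewrite le_max.
rewrite (_ : b - c = (a - c) - (a - b)); last by ring.
by have := absvB_max v_nonarch (a - c) (a - b); rewrite le_max.
Qed.

(** A neighbourhood of oo contains the complement of a compact set of seminorms, on which X - b is
    bounded, whereas its value at radius t is at least t. *)
Lemma infty_closure_gauss_path b (I : set R) :
  (forall M, exists2 t, I t & M < t) -> closure (gauss_path b @` I) (binfty v).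
Proof.
move=> Iub U [W [cW _] WU].
have [M WM] : exists M : R, forall S : berkA1 v, W S -> msn S ('X - b%:P) <= M.
  have : compact ((fun S : berkA1 v => msn S ('X - b%:P)) @` W).
    apply: continuous_compact => //; apply: continuous_subspaceT.
    exact: msn_continuous.
  move=> /compact_bounded [M [_ MP]]; exists (M + 1) => S WS.
  apply: le_trans (ler_norm _) _; apply: (MP (M + 1)); first by rewrite ltrDl.
  by exists S.
have [t It Mt] := Iub M.
exists (gauss_path b t); split; first by exists t.
apply: WU; left; exists (gp b t) => //= /WM.
rewrite gauss_point_XsubC => h.
have := le_trans (ler_norm t) (le_trans _ h); rewrite le_max lexx orbT => /(_ isT).
by rewrite leNgt Mt.
Qed.

Lemma ker_gauss_path_infty b t :
  g (gauss_path b t) (binfty v) = (Num.max 1 (Num.max (v b) `|t|))^-1.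
Proof.
have := ker_infty v_nonarch v_nontrivial gE (gp b t).
have -> : msn (gp b t) 'X = Num.max (v b) `|t|.
  by rewrite -['X]subr0 gauss_point_XsubC subr0.
move=> h; have m0 : Num.max 1 (Num.max (v b) `|t|) != 0.
  by rewrite gt_eqF// lt_max ltr01.
by apply: (mulIf m0); rewrite mulVf.
Qed.

Let ker_path b t a : g (gauss_path b t) (typeI v (Some a)) =
  Num.max (v (b - a)) `|t| *
  ((Num.max 1 (Num.max (v b) `|t|))^-1 * (Num.max 1 (v a))^-1).
Proof.
rewrite (ker_XsubC v_nonarch v_nontrivial gE) -/(gauss_path b t).
rewrite -gauss_path0 !ker_gauss_path_infty gauss_point_XsubC normr0.
by rewrite (max_l (absv_ge0 v a)).
Qed.

Let ker_ab a b : g (typeI v (Some b)) (typeI v (Some a)) =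
  v (b - a) * ((Num.max 1 (v b))^-1 * (Num.max 1 (v a))^-1).
Proof.
by rewrite -{1}gauss_path0 ker_path normr0 !(max_l (absv_ge0 v _)).
Qed.

(** The path climbs from a by growing disks up to the smallest disk containing b and descends to b.
    Along it the kernel with the centre a never exceeds its value at b. If a or b is oo, the path is
    a full ray completed by its limit point. *)
Lemma typeI_ball_path (a b : option K) r :
  g (typeI v b) (typeI v a) < r ->
  exists C : set P1, [/\ connected C, C (typeI v a), C (typeI v b) &
    C `<=` [set x | g x (typeI v a) < r]].
Proof.
have half : is_interval [set t : R | 0 <= t].
  by move=> x y /= x0 y0 z /andP[xz _]; exact: le_trans xz.
have halfub : forall M : R, exists2 t, 0 <= t & M < t.
  by move=> M; exists (`|M| + 1); [rewrite addr_ge0|rewrite ltr_pwDr// ler_norm].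
have withoo c : connected (gauss_path c @` [set t : R | 0 <= t] `|` [set (binfty v)]).
  apply: (connected_between (gauss_path_connected (b := c) half)).
    by move=> x; left.
  move=> x [|->]; first exact: subset_closure.
  exact: infty_closure_gauss_path.
case: a b => [a|] [b|] h.
- pose I := [set t : R | 0 <= t <= v (a - b)].
  have iI : is_interval I.
    move=> x y /= /andP[x0 _] /andP[_ y1] z /andP[xz zy].
    by rewrite /I /= (le_trans x0 xz) (le_trans zy y1).
  have I0 : I 0 by rewrite /I /= lexx absv_ge0.
  have I1 : I (v (a - b)) by rewrite /I /= lexx absv_ge0.
  exists (gauss_path a @` I `|` gauss_path b @` I); split.
  + apply: connectedU; [|exact: gauss_path_connected..].
    exists (gauss_path a (v (a - b))); split; first by exists (v (a - b)).
    by exists (v (a - b)) => //; rewrite gauss_path_eq.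
  + by left; exists 0 => //; rewrite gauss_path0.
  + by right; exists 0 => //; rewrite gauss_path0.
  + have h1 : 0 < Num.max 1 (v a) by rewrite lt_max ltr01.
    have h2 : 0 < Num.max 1 (v b) by rewrite lt_max ltr01.
    move=> x xP; apply: le_lt_trans h; rewrite ker_ab mulrA.
    case: xP => -[t /andP[t0 t1] <-]; rewrite ker_path (ger0_norm t0) mulrA.
    * rewrite subrr absv0 max_r// ler_pM2r ?invr_gt0//.
      have h3 : 0 < Num.max 1 (Num.max (v a) t) by rewrite lt_max ltr01.
      rewrite ler_pdivrMr// mulrAC ler_pdivlMr// absvB.
      have hb : Num.max 1 (v b) <= Num.max 1 (Num.max (v a) (v (a - b))).
        rewrite ge_max !le_max lexx /=.
        rewrite (_ : b = a - (a - b)); last by ring.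
        have := absvB_max v_nonarch a (a - b); rewrite le_max.
        rewrite (_ : a - (a - (a - b)) = a - b); last by ring.
        by move=> /orP[]->; rewrite ?orbT.
      (* t max(1,|b|) <= |a-b| max(1,|a|,t) *)
      rewrite (le_trans (ler_wpM2l t0 hb))//.
      rewrite !maxr_pMr// ?absv_ge0// !ge_max !le_max.
      have vab := absv_ge0 v (a - b).
      rewrite !mulr1 t1/=; apply/andP; split.
        by rewrite ler_wpM2r ?absv_ge0// orbT.
      by rewrite [t * _]mulrC lexx !orbT.
    * rewrite (max_l (_ : t <= v (b - a))); last by rewrite absvB.
      apply: ler_wpM2r; first by rewrite invr_ge0 ltW.
      apply: ler_wpM2l; first exact: absv_ge0.
      rewrite lef_pV2 ?posrE// ?lt_max ?ltr01//.
      by rewrite ge_max !le_max !lexx !orbT.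
- exists (gauss_path a @` [set t : R | 0 <= t] `|` [set (binfty v)]); split => //.
  + by left; exists 0; rewrite /= ?lexx// gauss_path0.
  + by right.
  + have h1 : 0 < Num.max 1 (v a) by rewrite lt_max ltr01.
    have hE : g (binfty v) (typeI v (Some a)) = (Num.max 1 (v a))^-1.
      rewrite (kerC v_nonarch v_nontrivial gE) -gauss_path0 ker_gauss_path_infty normr0.
      by rewrite (max_l (absv_ge0 v a)).
    move=> x [[t /= t0 <-]|-> //]; apply: le_lt_trans h.
    rewrite [leRHS]hE ker_path subrr absv0 (ger0_norm t0) max_r// mulrA.
    apply: ler_piMl; first by rewrite invr_ge0 ltW.
    rewrite ler_pdivrMr ?lt_max ?ltr01// mul1r.
    by rewrite !le_max lexx !orbT.
- exists (gauss_path b @` [set t : R | 0 <= t] `|` [set (binfty v)]); split => //.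
  + by right.
  + by left; exists 0; rewrite /= ?lexx// gauss_path0.
  + move=> x [[t /= t0 <-]|->] /=.
      apply: le_lt_trans h; rewrite -gauss_path0.
      rewrite -[typeI v None]/(binfty v) !ker_gauss_path_infty normr0.
      rewrite lef_pV2 ?posrE ?lt_max ?ltr01//.
      by rewrite !ge_max !le_max !lexx normr_ge0 !orbT.
    apply: le_lt_trans h; rewrite -[typeI v None]/(binfty v).
    rewrite -[binfty v in leLHS]/(typeI v None) (ker_typeI gE None None).
    rewrite /chordal /= mulr0 mul0r subrr absv0 mul0r.
    exact: (ker_ge0 v_nonarch v_nontrivial gE).
- exists [set (binfty v)]; split => //; first exact: connected1.
  by move=> x ->.
Qed.

Lemma typeI_ball_open a r : open [set x : P1 | g x (typeI v a) < r].
Proof.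
apply: (@open_comp _ _ (g^~ (typeI v a)) [set y : R | y < r]).
  by move=> x _; exact: (ker_continuousl gE).
exact: open_lt.
Qed.

(** The paths from the centre to the type I points of the ball have a connected union, which is
    dense in the ball; a set between a connected set and its closure is connected. *)
Lemma typeI_ball_connected a r : connected [set x : P1 | g x (typeI v a) < r].
Proof.
set U := [set x | _].
have [r0|r0] := ltP 0 r; last first.
  have -> : U = set0.
    apply/seteqP; split => // x /= h.
    by have := ker_ge0 v_nonarch v_nontrivial gE x (typeI v a); rewrite leNgt (lt_le_trans h).
  exact: connected0.
pose I := [set b : option K | U (typeI v b)].
have path b : exists C : set P1, I b -> [/\ connected C, C (typeI v a), C (typeI v b) & C `<=` U].
  have [/typeI_ball_path[C CP]|nI] := pselect (I b); first by exists C.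
  by exists set0.
have [C CP] := choice path.
apply: (@connected_between _ (\bigcup_(b in I) C b)).
- apply: bigcup_connected; last by move=> b /CP[].
  by exists (typeI v a) => b /CP[].
- by move=> x [b /CP[_ _ _ CU] Cx]; exact: CU.
- move=> x Ux.
  (* Adding the complement of [U], closed since [U] is open, gives a closed set to which density of
     all type I points applies. *)
  suff : (closure (\bigcup_(b in I) C b) `|` ~` U) x by case.
  apply: (typeI_dense v_nonarch v_nontrivial).
    apply: closedU; first exact: closed_closure.
    by apply: open_closedC; exact: typeI_ball_open.
  move=> b; have [Ib|Ib] := pselect (I b); last by right.
  by left; apply: subset_closure; exists b => //; case: (CP b Ib).
Qed.

(** Off E, a small chordal ball around the point is connected, misses E and meets the component,
    hence lies in it and makes the point interior. Thus the estimate is needed only at type I points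
    of E. *)
Lemma frontier_component_sub (E : set P1) (S0 : P1) (a : option K) :
  compact E -> frontier (connected_component (~` E) S0) (typeI v a) ->
  E (typeI v a).
Proof.
move=> cE [clD nint]; apply: contrapT => nEa; apply: nint.
have [r r0 rE] := compact_pos_lbound (ker_continuousl gE (y := typeI v a)) cE
  (fun x Ex => ker_gt0 v_nonarch v_nontrivial gE (fun e => nEa (eq_ind x E Ex _ e))).
pose U := [set x : P1 | g x (typeI v a) < r].
have Ua : U (typeI v a).
  by rewrite /U /= (ker_typeI_self gE).
have nU : nbhs (typeI v a) U by apply: open_nbhs_nbhs; split => //; exact: typeI_ball_open.
have [y [Dy Uy]] := clD U nU.
rewrite /interior /=; apply: filterS nU => x Ux.
have UE : U `<=` ~` E by move=> z Uz /rE; rewrite leNgt Uz.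
apply: connected_component_trans Dy _.
by exists U => //; split => //; exact: typeI_ball_connected.
Qed.

End Connected.

(** * Integration and Radon measures *)

(** The proof of unit mass is a phantom argument of this alias, which lets a probability structure
    be attached to any given measure; [robin] ranges over packaged probabilities. *)
Definition mass_one_probability d (T : measurableType d) (R : realType)
  (mu : {measure set T -> \bar R}) (mu1 : mu setT = 1%E) : set T -> \bar R := mu.

Section MassOne.
Context d (T : measurableType d) (R : realType).
Variables (mu : {measure set T -> \bar R}) (mu1 : mu setT = 1%E).

HB.instance Definition _ := Measure.copy (mass_one_probability mu1) mu.
HB.instance Definition _ :=
  Measure_isProbability.Build _ _ _ (mass_one_probability mu1) mu1.

End MassOne.

Section Integral.
Context d (T : measurableType d) (R : realType).
Implicit Types (mu : {measure set T -> \bar R}) (f h : T -> \bar R).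
Local Open Scope ereal_scope.
Import HBNNSimple.

(** No measurability of f or h is assumed: the integral of a nonnegative function is a supremum over
    simple functions, and these can be cut off to Y. It will be applied to integrands controlled
    only on a closed set of full mass. *)
Lemma ge0_le_integral_null mu (Y : set T) f h : measurable Y -> mu (~` Y) = 0 ->
  (forall x, 0 <= f x) -> (forall x, 0 <= h x) -> (forall x, Y x -> f x <= h x) ->
  \int[mu]_x f x <= \int[mu]_x h x.
Proof.
move=> mY Y0 f0 h0 fh.
rewrite ge0_integralTE//; apply: ge_ereal_sup => _ [s /= sf <-].
rewrite -integralT_nnsfun.
have ms (D : set T) : measurable_fun D (EFin \o s).
  by apply/measurable_EFinP; exact: measurable_funP.
have -> : \int[mu]_x (s x)%:E = \int[mu]_(x in Y) (s x)%:E.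
  rewrite (ge0_negligible_integral (measurableC mY) measurableT)//; last first.
    by move=> x _; rewrite lee_fin.
  by rewrite setDE setCK setTI.
rewrite integral_mkcond.
(* s times the indicator of Y: it has the same integral as s and lies below h everywhere. *)
pose s' := proj_nnsfun s mY.
have s'E x : (s' x)%:E = ((EFin \o s) \_ Y) x.
  rewrite /s' /= /mindic indicE patchE; case: (x \in Y) => /=; first by rewrite mulr1.
  by rewrite mulr0.
rewrite -(eq_integral _ _ (fun x _ => s'E x)) integralT_nnsfun [leRHS]ge0_integralTE//.
apply: ereal_sup_ubound; exists s' => //= x.
rewrite (_ : _%:E = ((EFin \o s) \_ Y) x); last by rewrite -s'E.
rewrite patchE; case: ifPn => [|_]; last exact: h0.
by rewrite inE => Yx; apply: le_trans (sf x) (fh x Yx).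
Qed.

Lemma eq_integral_null mu (Y : set T) f h : measurable Y -> mu (~` Y) = 0 ->
  (forall x, Y x -> f x = h x) -> \int[mu]_x f x = \int[mu]_x h x.
Proof.
move=> mY Y0 fh; rewrite integralE [RHS]integralE.
congr (_ - _); apply/eqP; rewrite eq_le; apply/andP; split;
  by apply: (ge0_le_integral_null mY Y0) => // x /fh e; rewrite ?funeposE ?funenegE e.
Qed.

(** The integral of f may be infinite. In that case the positive part of c - f is bounded by |c| and
    the negative part has infinite integral, so both sides are -oo. *)
Lemma integral_csts_sub mu (c : R) f : mu setT = 1 -> measurable_fun setT f ->
  (forall x, 0 <= f x) -> \int[mu]_x (c%:E - f x) = c%:E - \int[mu]_x f x.
Proof.
move=> mu1 mf f0.
have cE (k : R) : \int[mu]_x (cst k%:E x) = k%:E.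
  by rewrite integral_cst// mu1 mule1.
have icst : mu.-integrable setT (cst c%:E).
  apply/integrableP; split; first exact: measurable_cst.
  by rewrite /= integral_cst// mu1 mule1 ltry.
have [fy|fy] := ltP (\int[mu]_x f x) +oo.
  have If : mu.-integrable setT f.
    apply/integrableP; split => //.
    by under eq_integral do rewrite gee0_abs//.
  by rewrite (integralB measurableT icst If) cE.
have fyE : \int[mu]_x f x = +oo by apply/eqP; rewrite eq_le fy leey.
pose h x := c%:E - f x.
have mh : measurable_fun setT h by apply: emeasurable_funB.
rewrite fyE -/h integralE.
have pos : \int[mu]_x h^\+ x <= `|c|%:E.
  rewrite -(cE `|c|%R); apply: ge0_le_integral => //.
  - exact: measurable_funepos.
  - move=> x _; rewrite funeposE ge_max /= lee_fin normr_ge0 andbT.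
    rewrite /h; have := f0 x; case: (f x) => [r| |] //= r0; last by rewrite leNye.
    rewrite -EFinB lee_fin; move: r0; rewrite lee_fin => r0.
    by rewrite (le_trans _ (ler_norm _))// gerBl.
have neg : \int[mu]_x h^\- x = +oo.
  apply/eqP; rewrite eq_le leey /=.
  have : +oo <= \int[mu]_x (cst `|c|%:E x + h^\- x).
    rewrite -fyE; apply: ge0_le_integral => //.
    - by apply: emeasurable_funD; [exact: measurable_cst|exact: measurable_funeneg].
    - move=> x _; rewrite funenegE /h /=.
      have := f0 x; case: (f x) => [r| |] //= _.
      apply: (@le_trans _ _ (`|c|%:E + (- (c - r))%:E)).
        by rewrite -EFinD lee_fin; have := ler_norm c; lra.
      by rewrite leeD2l// le_max lexx.
  rewrite ge0_integralD//; last 2 first.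
  - by move=> x _; rewrite /= lee_fin.
  - exact: measurable_funeneg.
  rewrite cE; case: (\int[mu]_x h^\- x) => //.
rewrite neg /=; move: pos; have : 0 <= \int[mu]_x h^\+ x by apply: integral_ge0.
by case: (\int[mu]_x h^\+ x).
Qed.

Lemma integral_mrestr mu (Y : set T) (mY : measurable Y) f :
  measurable_fun setT f -> (forall x, 0 <= f x) ->
  \int[mrestr mu mY]_x f x = \int[mu]_(x in Y) f x.
Proof.
move=> mf f0.
rewrite (ge0_negligible_integral (measurableC mY) measurableT)//; last first.
  by rewrite /= /mrestr setICl.
rewrite setDE setCK setTI.
apply: eq_measure_integral => A mA AY; rewrite /= /mrestr.
by rewrite (setIidl AY).
Qed.

Definition mix (a b : {nonneg R}) mu (tau : {measure set T -> \bar R}) :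
    {measure set T -> \bar R} :=
  measure_add (mscale a mu) (mscale b tau).

Lemma mixE a b mu tau A :
  mix a b mu tau A = a%:num%:E * mu A + b%:num%:E * tau A.
Proof. exact: measure_addE. Qed.

Lemma integral_mix a b mu tau f : measurable_fun setT f -> (forall x, 0 <= f x) ->
  \int[mix a b mu tau]_x f x =
  a%:num%:E * \int[mu]_x f x + b%:num%:E * \int[tau]_x f x.
Proof.
by move=> mf f0; rewrite ge0_integral_measure_add// !ge0_integral_mscale.
Qed.

End Integral.

Section Radon.
Context {R : realType} {K : closedFieldType} (v : absolute_value R K).
Local Notation P1 := (berkP1 v).
Local Notation X := (borelP1 v).
Implicit Types (mu tau : {measure set X -> \bar R}).
Local Open Scope ereal_scope.

Lemma open_measurableP1 (A : set P1) : open A -> measurable (A : set X).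
Proof. by move=> oA; apply: sub_sigma_algebra. Qed.

Lemma closed_measurableP1 (A : set P1) : closed A -> measurable (A : set X).
Proof.
move=> cA; rewrite -[A]setCK; apply: measurableC.
by apply: open_measurableP1; exact: closed_openC.
Qed.

Lemma lsc_measurable (f : X -> \bar R) :
  (forall t : R, open [set x : P1 | t%:E < f x]) -> measurable_fun setT f.
Proof.
move=> lf; apply: (measurability _ (ErealGenOInfty.measurableE R)).
move=> _ [_ [t ->] <-]; rewrite setTI.
have -> : f @^-1` `]t%:E, +oo[%classic = [set x : P1 | t%:E < f x].
  by apply/seteqP; split => x /=; rewrite in_itv /= andbT.
exact: open_measurableP1.
Qed.

Hypothesis hausP1 : hausdorff_space P1.

Lemma compact_measurableP1 (A : set P1) : compact A -> measurable (A : set X).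
Proof. by move=> cA; apply: closed_measurableP1; exact: compact_closed. Qed.

(** Every point of U has a null open neighbourhood, but uncountably many of them may be needed to
    cover U. Inner regularity reduces to compact subsets of U, where finitely many suffice. *)
Lemma radon_null mu (E U : set P1) : radon mu -> msupport mu `<=` E ->
  open U -> (forall x, U x -> ~ E x) -> mu U = 0.
Proof.
move=> rmu smu oU UE.
rewrite (rmu _ (open_measurableP1 oU)).
apply/eqP; rewrite eq_le; apply/andP; split; last first.
  apply: ereal_sup_ubound; exists set0; last by rewrite measure0.
  by split => //; exact: compact0.
apply: ge_ereal_sup => _ [C [/= cC CU] <-].
have nullnb x : exists V : set P1, U x -> [/\ open V, V x & mu V = 0].
  have [Ux|nUx] := pselect (U x); last by exists set0.
  have : ~ msupport mu x by move=> /smu; exact: UE.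
  move=> /existsNP[V] /not_implyP[oV] /not_implyP[Vx] /negP V0.
  exists V => _; split => //; apply/eqP.
  by move: V0; rewrite -leNgt measure_le0.
have [V VP] := choice nullnb.
have mC := compact_measurableP1 cC.
have := cC; rewrite compact_cover => /(_ _ U V).
case.
- by move=> i /VP[].
- by move=> x Cx; exists x; [exact: CU|case: (VP x (CU x Cx))].
move=> D DU CD.
have [mW W0] : measurable (cover [set` D] V : set X) /\ mu (cover [set` D] V) = 0.
  rewrite /cover bigcup_fset.
  have : forall i, i \in enum_fset D -> U i.
    by move=> i /DU; rewrite inE.
  elim: (enum_fset D) => [_|i s ih hs].
    by rewrite big_nil measure0.
  have [Vo _ V0] := VP i (hs i (mem_head _ _)).
  have [mW W0] : measurable (\big[setU/set0]_(i <- s) V i : set X) /\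
      mu (\big[setU/set0]_(i <- s) V i) = 0.
    by apply: ih => j js; apply: hs; rewrite inE js orbT.
  have mV := open_measurableP1 Vo.
  rewrite big_cons; split; first exact: measurableU.
  by rewrite measureU0.
by rewrite -W0 le_measure ?inE.
Qed.

Lemma radon_approx mu (A : set X) (e : R) : radon mu -> mu setT < +oo ->
  measurable A -> (0 < e)%R ->
  exists C : set P1, [/\ compact C, C `<=` A & mu A <= mu C + e%:E].
Proof.
move=> rmu fmu mA e0.
have fA : mu A \is a fin_num.
  rewrite ge0_fin_numE//; apply: le_lt_trans fmu.
  by rewrite le_measure ?inE.
have muE := rmu _ mA.
have [|_ [C [/= cC CA] <-] h] := @ub_ereal_sup_adherent _
  [set mu C | C in [set C : set P1 | compact C /\ C `<=` A]] _ e0.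
  by rewrite -muE.
exists C; split => //; move: h; rewrite -muE => /ltW.
by rewrite EFinN leeBlDr.
Qed.

Lemma approx_radon mu : mu setT < +oo ->
  (forall (A : set X) (e : R), measurable A -> (0 < e)%R ->
    exists C : set P1, [/\ compact C, C `<=` A & mu A <= mu C + e%:E]) ->
  radon mu.
Proof.
move=> fmu h A mA; apply/eqP; rewrite eq_le; apply/andP; split.
  apply/lee_addgt0Pr => e e0.
  have [C [cC CA muAC]] := h A e mA e0.
  apply: le_trans muAC _; rewrite leeD2r//.
  by apply: ereal_sup_ubound; exists C.
apply: ge_ereal_sup => _ [C [/= cC CA] <-].
by rewrite le_measure ?inE//; exact: compact_measurableP1.
Qed.

Lemma radon_mix (a b : {nonneg R}) mu tau :
  radon mu -> radon tau -> mu setT < +oo -> tau setT < +oo ->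
  radon (mix a b mu tau).
Proof.
move=> rmu rtau fmu ftau.
have fin (m : {measure set X -> \bar R}) (A : set X) : m setT < +oo -> measurable A ->
    m A \is a fin_num.
  move=> fm mA; rewrite ge0_fin_numE//; apply: le_lt_trans fm.
  by rewrite le_measure ?inE.
apply: approx_radon.
  rewrite mixE -ge0_fin_numE; last by rewrite adde_ge0// mule_ge0.
  by rewrite fin_numD !fin_numM// fin.
move=> A e mA e0.
(* The two errors are weighted by a and b; the extra 1 keeps the denominator positive when both
   vanish. *)
pose e' := (e / (a%:num + b%:num + 1))%R.
have ab0 : (0 < a%:num + b%:num + 1 :> R)%R.
  by rewrite ltr_wpDl// addr_ge0.
have e'0 : (0 < e')%R by rewrite divr_gt0.
have [C1 [cC1 C1A mu1]] := radon_approx rmu fmu mA e'0.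
have [C2 [cC2 C2A tau2]] := radon_approx rtau ftau mA e'0.
have mC1 := compact_measurableP1 cC1.
have mC2 := compact_measurableP1 cC2.
have mC12 : measurable (C1 `|` C2 : set X) by exact: measurableU.
exists (C1 `|` C2); split.
- exact: compactU.
- by move=> x [/C1A|/C2A].
rewrite !mixE.
have {mu1} : mu A <= mu (C1 `|` C2) + e'%:E.
  by apply: le_trans mu1 _; rewrite leeD2r// le_measure ?inE//; left.
have {tau2} : tau A <= tau (C1 `|` C2) + e'%:E.
  by apply: le_trans tau2 _; rewrite leeD2r// le_measure ?inE//; right.
rewrite -(fineK (fin mu _ fmu mA)) -(fineK (fin tau _ ftau mA)).
rewrite -(fineK (fin mu _ fmu mC12)) -(fineK (fin tau _ ftau mC12)).
move: (fine _) (fine _) (fine _) (fine _) => p q r s.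
rewrite -!EFinM -!EFinD !lee_fin => h1 h2.
have ee : (e = e' * (a%:num + b%:num + 1))%R by rewrite /e' divfK// gt_eqF.
have a0 : (0 <= a%:num :> R)%R by [].
have b0 : (0 <= b%:num :> R)%R by [].
rewrite ee; nra.
Qed.

Lemma radon_mrestr mu (Y : set X) (mY : measurable Y) :
  radon mu -> mu setT < +oo -> radon (mrestr mu mY).
Proof.
move=> rmu fmu; apply: approx_radon => [|A e mA e0].
  rewrite /= /mrestr setTI; apply: le_lt_trans fmu.
  by rewrite le_measure ?inE.
have [C [cC CAY muC]] := radon_approx rmu fmu (measurableI _ _ mA mY) e0.
exists C; split => //; first by move=> x /CAY[].
by rewrite /= /mrestr [C `&` Y]setIidl// => x /CAY[].
Qed.

Lemma msupport_mrestr mu (Y : set X) (mY : measurable Y) (E : set P1) :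
  msupport mu `<=` E -> msupport (mrestr mu mY) `<=` E.
Proof.
move=> smu; apply: subset_trans smu => x xs U oU Ux.
apply: lt_le_trans (xs U oU Ux) _ => /=.
have mU := open_measurableP1 oU.
by rewrite /mrestr le_measure ?inE//; exact: measurableI.
Qed.

Lemma msupport_mix (a b : {nonneg R}) mu tau (E : set P1) :
  msupport mu `<=` E -> msupport tau `<=` E -> msupport (mix a b mu tau) `<=` E.
Proof.
move=> smu stau x xs; apply: contrapT => nEx.
have null m : msupport m `<=` E -> exists U : set P1, [/\ open U, U x & m U = 0].
  move=> sm; have : ~ msupport m x by move=> /sm.
  move=> /existsNP[U] /not_implyP[oU] /not_implyP[Ux] /negP U0.
  by exists U; split => //; apply/eqP; move: U0; rewrite -leNgt measure_le0.
have [U1 [oU1 U1x mu0]] := null _ smu.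
have [U2 [oU2 U2x tau0]] := null _ stau.
have mU1 := open_measurableP1 oU1; have mU2 := open_measurableP1 oU2.
have := xs (U1 `&` U2) (openI oU1 oU2) (conj U1x U2x).
rewrite mixE (@subset_measure0 _ _ _ _ _ (U1 : set X)) ?mule0//; last exact: measurableI.
rewrite add0e (@subset_measure0 _ _ _ _ _ (U2 : set X)) ?mule0 ?ltxx//.
exact: measurableI.
Qed.

Lemma radon_dirac (x : X) : radon (dirac x : {measure set X -> \bar R}).
Proof.
apply: approx_radon => [|A e mA e0]; first by rewrite /= diracT ltry.
have [Ax|nAx] := pselect (A x).
  exists [set x]; split; [exact: compact_set1|by move=> _ ->|].
  rewrite /= !diracE !mem_set//=.
  by rewrite -EFinD lee_fin lerDl ltW.
exists set0; split => //; first exact: compact0.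
by rewrite measure0 add0e /= diracE memNset// lee_fin ltW.
Qed.

End Radon.

(** * Truncated potentials *)

Section Potential.
Context {R : realType} {K : closedFieldType} (v : absolute_value R K).
Hypothesis v_nonarch : nonarchimedean_abs v.
Hypothesis v_nontrivial : nontrivial_abs v.
Local Notation g := (@chordal_kernel R K v).
Hypothesis gE : chordal_extension g.
Local Notation P1 := (berkP1 v).
Local Notation X := (borelP1 v).
Variables (S0 : P1) (M : R).
Implicit Types (tau : {measure set X -> \bar R}) (x y z w : P1) (Y : set P1).

Let g0 x y : 0 <= g x y := ker_ge0 v_nonarch v_nontrivial gE x y.
Let gC x y : g x y = g y x := kerC v_nonarch v_nontrivial gE x y.

(* M - log [x, y]_S0 truncated at 0; exact where the kernel is at most e^M. *)
Definition log_gap x y : \bar R :=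
  if g x S0 * g y S0 == 0 then 0%E else
  if g x y == 0 then +oo%E else
  (Num.max 0 (M - ln (g x y / (g x S0 * g y S0))))%:E.

Lemma log_gap_ge0 x y : (0 <= log_gap x y)%E.
Proof.
rewrite /log_gap; case: ifP => // _; case: ifP => // _.
by rewrite lee_fin le_max lexx.
Qed.

Lemma log_gapC x y : log_gap x y = log_gap y x.
Proof. by rewrite /log_gap (gC x y) (mulrC (g x S0)). Qed.

Lemma le_log_gap t x y : 0 < t -> (t%:E <= log_gap x y)%E =
  [&& 0 < g x S0, 0 < g y S0 & g x y <= expR (M - t) * (g x S0 * g y S0)].
Proof.
move=> t0; rewrite /log_gap mulf_eq0.
have [x0|x0] := eqVneq (g x S0) 0.
  by rewrite /= lee_fin leNgt t0 x0 ltxx.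
have [y0|y0] := eqVneq (g y S0) 0.
  by rewrite /= lee_fin leNgt t0 y0 ltxx andbF.
have {}x0 : 0 < g x S0 by rewrite lt_def x0 g0.
have {}y0 : 0 < g y S0 by rewrite lt_def y0 g0.
have xy0 : 0 < g x S0 * g y S0 by rewrite mulr_gt0.
rewrite x0 y0 /=; case: eqVneq => [->|xy].
  by rewrite leey mulr_ge0 ?expR_ge0// ltW.
have kxy : 0 < g x y / (g x S0 * g y S0) by rewrite divr_gt0// lt_def xy g0.
rewrite lee_fin le_max leNgt t0 /= lerBrDr addrC -lerBrDr.
by rewrite -ler_pdivrMr// -ler_expR lnK.
Qed.

Lemma lt_log_gap t x y : 0 <= t -> (t%:E < log_gap x y)%E =
  [&& 0 < g x S0, 0 < g y S0 & g x y < expR (M - t) * (g x S0 * g y S0)].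
Proof.
move=> t0; rewrite /log_gap mulf_eq0.
have [x0|x0] := eqVneq (g x S0) 0.
  by rewrite /= lte_fin ltNge t0 x0 ltxx.
have [y0|y0] := eqVneq (g y S0) 0.
  by rewrite /= lte_fin ltNge t0 y0 ltxx andbF.
have {}x0 : 0 < g x S0 by rewrite lt_def x0 g0.
have {}y0 : 0 < g y S0 by rewrite lt_def y0 g0.
have xy0 : 0 < g x S0 * g y S0 by rewrite mulr_gt0.
rewrite x0 y0 /=; case: eqVneq => [->|xy].
  by rewrite ltey mulr_gt0 ?expR_gt0.
have kxy : 0 < g x y / (g x S0 * g y S0) by rewrite divr_gt0// lt_def xy g0.
rewrite lte_fin lt_max ltNge t0 /= ltrBrDr addrC -ltrBrDr.
by rewrite -ltr_pdivrMr// -ltr_expR lnK.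
Qed.

Let lt_open (F G : P1 -> R) : continuous F -> continuous G ->
  open [set x | F x < G x].
Proof.
move=> cF cG; rewrite -closedC (_ : ~` _ = [set x | G x <= F x]).
  exact: closed_le_continuous.
by apply/seteqP; split => x /=; rewrite leNgt => /negP.
Qed.

Lemma log_gap_lsc x (t : R) : open [set y | (t%:E < log_gap x y)%E].
Proof.
have [t0|t0] := ltP t 0.
  rewrite (_ : mkset _ = setT); first exact: openT.
  apply/seteqP; split => // y _ /=.
  by apply: lt_le_trans (log_gap_ge0 _ _); rewrite lte_fin.
have [x0|x0] := boolP (0 < g x S0); last first.
  rewrite (_ : mkset _ = set0); first exact: open0.
  by apply/seteqP; split => // y /=; rewrite lt_log_gap// (negbTE x0).
rewrite (_ : mkset _ = [set y | 0 < g y S0] `&`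
    [set y | g x y < expR (M - t) * (g x S0 * g y S0)]).
  apply: openI; apply: lt_open.
  - exact: cst_continuous.
  - exact: (ker_continuousl gE).
  - exact: (ker_continuousr gE).
  - apply: continuous_mul_fun; first exact: cst_continuous.
    apply: continuous_mul_fun; first exact: cst_continuous.
    exact: (ker_continuousl gE).
by apply/seteqP; split => y /=; rewrite lt_log_gap// x0 /= => /andP.
Qed.

Lemma measurable_log_gap x : measurable_fun setT (log_gap x : X -> \bar R).
Proof. by apply: lsc_measurable => t; exact: log_gap_lsc. Qed.

(** [ker_ptolemy] with fourth point [S0], divided by the product of the three distances to [S0]. *)
Lemma hsia_ultra x y z : 0 < g x S0 -> 0 < g y S0 -> 0 < g z S0 ->
  g x z / (g x S0 * g z S0) <=
  Num.max (g x y / (g x S0 * g y S0)) (g y z / (g y S0 * g z S0)).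
Proof.
move=> x0 y0 z0.
have e0 : 0 < g x S0 * g y S0 * g z S0 by rewrite !mulr_gt0.
rewrite -(ler_pM2r e0) [X in _ <= X]maxr_pMl; last exact: ltW.
have := ker_ptolemy v_nonarch v_nontrivial gE x y z S0.
set A := (X in X <= _); set B := Num.max _ _ => AB.
set C := (X in (_ <= X)).
have -> : g x z / (g x S0 * g z S0) * (g x S0 * g y S0 * g z S0) = A.
  by rewrite /A; field; rewrite !gt_eqF.
suff -> : C = B by [].
by rewrite /C /B; congr Num.max; field; rewrite !gt_eqF.
Qed.

(* Since [x, x] <= [x, w], the ultrametric inequality gives
   [x', w] <= max(eta, [x, w]) uniformly in w as soon as [x', x] < eta. *)
Lemma log_gap_near x (e N : R) : 0 < e -> 0 < g x S0 ->
  exists W : set P1, [/\ open W, W x & forall x' w t, W x' -> t <= N ->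
    (t%:E <= log_gap x w -> t%:E <= log_gap x' w + e%:E)%E].
Proof.
move=> e0 x0.
pose k y z := g y z / (g y S0 * g z S0).
(* The second term keeps eta positive when [k x x] is zero, as at type I points, and costs nothing
   at levels t <= N. *)
pose eta := Num.max (k x x * expR e) (expR (M - N)).
have k0 y z : 0 <= k y z by rewrite divr_ge0 ?mulr_ge0.
exists ([set x' | 0 < g x' S0] `&` [set x' | g x' x < eta * (g x' S0 * g x S0)]).
split.
- apply: openI; apply: lt_open.
  + exact: cst_continuous.
  + exact: (ker_continuousl gE).
  + exact: (ker_continuousl gE).
  + apply: continuous_mul_fun; first exact: cst_continuous.
    by apply: continuous_mul_fun; [exact: (ker_continuousl gE)|exact: cst_continuous].
- split => //=; rewrite -ltr_pdivrMr ?mulr_gt0// -/(k x x) lt_max.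
  have [->|kx] := eqVneq (k x x) 0; first by rewrite expR_gt0 orbT.
  by rewrite ltr_pMr ?expR_gt1 ?e0// lt_def kx k0.
move=> x' w t [/= x'0 x'x] tN h.
have gap0 := log_gap_ge0 x' w.
have [te|et] := leP (t - e) 0.
  apply: (@le_trans _ _ (0 + e%:E)%E); last by rewrite leeD2r.
  by rewrite add0e lee_fin; lra.
rewrite -leeBlDr// -EFinB le_log_gap//.
move: h; rewrite le_log_gap; last lra.
move=> /and3P[_ w0 h]; rewrite x'0 w0 /=.
have xw0 : 0 < g x S0 * g w S0 by rewrite mulr_gt0.
have x'w0 : 0 < g x' S0 * g w S0 by rewrite mulr_gt0.
move: h; rewrite -!ler_pdivrMr// -/(k x w) -/(k x' w) => h.
apply: le_trans (hsia_ultra x'0 x0 w0) _.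
have ext : expR (M - t) <= expR (M - (t - e)) by rewrite ler_expR; lra.
rewrite -/(k x' x) -/(k x w) ge_max (le_trans h ext) andbT.
have : k x' x < eta by rewrite /k ltr_pdivrMr// mulr_gt0.
move/ltW/le_trans; apply; rewrite /eta ge_max; apply/andP; split.
  rewrite (_ : M - (t - e) = (M - t) + e); last by ring.
  rewrite expRD ler_pM2r ?expR_gt0//; apply: le_trans h.
  have := hsia_ultra x0 w0 x0; rewrite -/(k x w) -/(k w x) -/(k x x).
  have -> : k w x = k x w by rewrite /k gC (mulrC (g w S0)).
  by rewrite maxxx.
by rewrite ler_expR; lra.
Qed.

Definition gap_potential tau x : \bar R := (\int[tau]_y log_gap x y)%E.

Lemma gap_potential_ge0 tau x : (0 <= gap_potential tau x)%E.
Proof. by apply: integral_ge0 => y _; exact: log_gap_ge0. Qed.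

Import HBNNSimple HBSimple.

Let scale_lt (p q : R) : 0 < p -> 0 <= q -> p / (q + 1) / 2 * q < p.
Proof.
move=> p0 q0; have q1 : 0 < q + 1 by lra.
have : p / (q + 1) / 2 * (q + 1) = p / 2 by field; rewrite gt_eqF.
have : 0 < p / (q + 1) / 2 by rewrite !divr_gt0.
nra.
Qed.

(** Uniformity in w of [log_gap_near] replaces Fatou's lemma, since the topology need not be first
    countable. Semicontinuity makes the potential Borel, so that it can be integrated again. *)
Lemma gap_potential_lsc tau (t : R) : (tau setT < +oo)%E ->
  open [set x : P1 | (t%:E < gap_potential tau x)%E].
Proof.
move=> ftau.
rewrite openE => x /= tPx.
have [t0|t0] := ltP t 0.
  rewrite /interior (_ : mkset _ = setT); first exact: filterT.
  apply/seteqP; split => // y _ /=.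
  by apply: lt_le_trans (gap_potential_ge0 _ _); rewrite lte_fin.
have [x0|x0] := boolP (0 < g x S0); last first.
  exfalso; move: tPx; rewrite /gap_potential.
  have -> : log_gap x = cst 0%E.
    apply/funext => y; rewrite /log_gap mulf_eq0 -[g x S0 == 0]negbK.
    have := x0; rewrite lt_def g0 andbT => /negPn ->.
    by [].
  by rewrite integral_cst// mul0e lte_fin ltNge t0.
move: tPx; rewrite /gap_potential ge0_integralTE; last exact: log_gap_ge0.
(* A simple function below the gap already has integral above t; its bound supplies the level N for
   [log_gap_near]. *)
move=> /ereal_sup_gt[_ [s /= sg <-]]; rewrite -integralT_nnsfun => ts.
have [N [_ Nb]] := simple_bounded s.
have sN w : s w <= N + 1.
  apply: le_trans (ler_norm _) _; apply: (Nb (N + 1)) => //.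
  by rewrite ltrDl.
have T0 : tau setT \is a fin_num by rewrite ge0_fin_numE.
have ms : measurable_fun setT (EFin \o s).
  by apply/measurable_EFinP; exact: measurable_funP.
have fs : (\int[tau]_w (s w)%:E \is a fin_num)%E.
  rewrite ge0_fin_numE; last by apply: integral_ge0 => w _; rewrite lee_fin.
  apply: (@le_lt_trans _ _ (\int[tau]_w (cst (N + 1)%:E w))%E).
    apply: ge0_le_integral => //; first by move=> w _; rewrite lee_fin.
    - by move=> w _; rewrite lee_fin sN.
  rewrite integral_cst// -(fineK T0) -EFinM ltry//.
move: ts; rewrite -(fineK fs); set I := fine _; rewrite lte_fin => tI.
pose m := fine (tau setT).
have m0 : 0 <= m by exact: fine_ge0.
pose e := (I - t) / (m + 1) / 2.
have e0 : 0 < e by rewrite /e !divr_gt0//; lra.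
have [W [oW Wx WP]] := log_gap_near (N + 1) e0 x0.
apply: (@filterS _ (nbhs x) _ W); last exact: open_nbhs_nbhs.
move=> x' Wx' /=.
have : (I%:E <= gap_potential tau x' + (e * m)%:E)%E.
  rewrite /I fineK// /gap_potential EFinM (fineK T0) -integral_cst//.
  rewrite -ge0_integralD//; last 3 first.
  - by move=> w _; exact: log_gap_ge0.
  - exact: measurable_log_gap.
  - by move=> w _; rewrite lee_fin ltW.
  apply: ge0_le_integral => //.
  - by move=> w _; rewrite lee_fin.
  - by apply: emeasurable_funD; [exact: measurable_log_gap|exact: measurable_cst].
  - by move=> w _; apply: WP.
have em : e * m < I - t by apply: scale_lt => //; rewrite subr_gt0.
have := gap_potential_ge0 tau x'; rewrite /gap_potential.
case: (integral _ _ _) => [p| |] //= _; last by rewrite ltry.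
by rewrite -EFinD lee_fin lte_fin; lra.
Qed.

Lemma measurable_gap_potential tau : (tau setT < +oo)%E ->
  measurable_fun setT (gap_potential tau : X -> \bar R).
Proof. by move=> ftau; apply: lsc_measurable => t; exact: gap_potential_lsc. Qed.

Definition gap_energy tau : \bar R := (\int[tau]_x gap_potential tau x)%E.

Section Exact.
Variable Y : set P1.
Hypothesis Y_pos : forall x, Y x -> 0 < g x S0.
Hypothesis Y_le : forall x y, Y x -> Y y ->
  g x y <= expR M * (g x S0 * g y S0).

(** [Y_le] bounds the kernel by e^M on Y, so the truncation is inactive there; where [g x y] is zero
    both sides are -oo. *)
Lemma lne_hsiaE x y : Y x -> Y y ->
  lne (hsia S0 x y) = (M%:E - log_gap x y)%E.
Proof.
move=> Yx Yy; rewrite /hsia /log_gap.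
have xy0 : 0 < g x S0 * g y S0 by rewrite mulr_gt0 ?Y_pos.
rewrite gt_eqF//; have [->|xy] := eqVneq (g x y) 0.
  by rewrite mul0r /= lexx.
have kxy : 0 < g x y / (g x S0 * g y S0) by rewrite divr_gt0// lt_def xy g0.
rewrite lne_EFin// max_r; first by rewrite -EFinB; congr EFin; ring.
by rewrite subr_ge0 -ler_expR lnK// ler_pdivrMr// Y_le.
Qed.

Hypothesis mY : measurable (Y : set X).

Lemma potentialE tau x : tau setT = 1%E -> tau (~` Y) = 0%E -> Y x ->
  potential S0 tau x = (M%:E - gap_potential tau x)%E.
Proof.
move=> tau1 tauY Yx; rewrite /potential -integral_csts_sub//.
- by apply: (eq_integral_null mY tauY) => y Yy; exact: lne_hsiaE.
- exact: measurable_log_gap.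
- by move=> y; exact: log_gap_ge0.
Qed.

Lemma energyE tau : tau setT = 1%E -> tau (~` Y) = 0%E ->
  energy S0 tau = (M%:E - gap_energy tau)%E.
Proof.
move=> tau1 tauY; rewrite /energy -integral_csts_sub//.
- by apply: (eq_integral_null mY tauY) => y Yy; exact: potentialE.
- by apply: measurable_gap_potential; rewrite tau1 ltry.
- by move=> y; exact: gap_potential_ge0.
Qed.

End Exact.

End Potential.

(** * Variation of the equilibrium energy *)

(** A first-order condition at s = 0. For negative c1, the explicit s makes the quadratic term at
    most half of the linear one. *)
Lemma ge0_linear_coef (R : realType) (c1 c2 : R) :
  (forall s, 0 < s < 1 -> 0 <= c1 * s + c2 * s ^+ 2) -> 0 <= c1.
Proof.
move=> h; rewrite leNgt; apply/negP => c1n.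
pose d := `|c2| + `|c1| + 1.
have n1 := normr_ge0 c1; have n2 := normr_ge0 c2.
have d0 : 0 < d by rewrite /d; lra.
pose s := - c1 / d / 2.
have sd : s * d = - c1 / 2 by rewrite /s; field; rewrite gt_eqF.
have s0 : 0 < s by rewrite /s !divr_gt0//; lra.
have s1 : s < 1.
  rewrite -(ltr_pM2r d0) sd mul1r /d.
  by have := ler_norm (- c1); rewrite normrN; lra.
have := h s; rewrite s0 s1 => /(_ isT).
have : c2 * s <= s * d by have := ler_norm c2; rewrite /d; nra.
rewrite sd; nra.
Qed.

(** The letters stand for gap energies: j of nu, p of its outer part, b of its inner part, t of the
    test measure; n is the mass inside the ball and l the outer integral of the gap to the centre.
    The hypotheses state minimality of j against the two families of competitors. *)
Lemma quadratic_variation (R : realType) (j t b p l n : R) :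
  0 <= n -> 0 <= b -> j = p + 2 * (n * l) + b ->
  (forall al be, 0 <= al -> 0 <= be -> al * (1 - n) + be = 1 ->
    j <= al ^+ 2 * p + al * be * 2 * l + be ^+ 2 * t) ->
  (forall al be, 0 <= al -> 0 <= be -> al * (1 - n) + be * n = 1 ->
    j <= al ^+ 2 * p + al * be * 2 * (n * l) + be ^+ 2 * b) ->
  n <= 1 -> j <= l + n * t.
Proof.
move=> n0 b0 jE h1 h2 n1.
have [n_eq0|n_neq0] := eqVneq n 0.
  (* With no mass inside, the competitor is (1 - s) out + s tau, to first order in s. *)
  suff : 0 <= 2 * (l - j) by rewrite n_eq0; lra.
  apply: (@ge0_linear_coef _ _ (t + j - 2 * l)) => s /andP[s0 s1].
  have := h1 (1 - s) s ltac:(lra) ltac:(lra) ltac:(rewrite n_eq0; lra).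
  have : p <= j by rewrite jE n_eq0; lra.
  have : 0 <= (1 - s) ^+ 2 by exact: sqr_ge0.
  nra.
have {n_neq0}n_gt0 : 0 < n by rewrite lt_def n_neq0.
(* The competitor out + n tau has the same outer and cross terms as nu, which leaves only the inner
   energies to compare. *)
have bt : b <= n ^+ 2 * t.
  have := h1 1 n ltac:(lra) n0 ltac:(lra).
  rewrite jE; lra.
(* Shrinking the outer part by 1 - s requires growing the inner part by 1 + s q to keep mass one.
   The first-order condition in s, the bound on b and q + 1 = 1/n give the claim. *)
pose q := (1 - n) / n.
have qn : q * n = 1 - n by rewrite /q divfK// gt_eqF.
have q0 : 0 <= q by rewrite /q divr_ge0//; lra.
have : 0 <= 2 * (- p + (q - 1) * (n * l) + q * b).
  apply: (@ge0_linear_coef _ _ (p - 2 * q * (n * l) + q ^+ 2 * b)) => s /andP[s0 s1].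
  have qs0 : 0 <= 1 + s * q by rewrite addr_ge0// mulr_ge0// ltW.
  have e : (1 - s) * (1 - n) + (1 + s * q) * n = 1.
    have sqn : s * q * n = s * (1 - n) by rewrite -mulrA qn.
    transitivity ((1 - s) * (1 - n) + n + s * q * n); first by ring.
    by rewrite sqn; ring.
  have := h2 (1 - s) (1 + s * q) ltac:(lra) qs0 e.
  rewrite jE -subr_ge0; congr (0 <= _); ring.
have bn : q * b + b <= n * t.
  have -> : q * b + b = b / n by rewrite /q; field; rewrite gt_eqF.
  by rewrite ler_pdivrMr//; move: bt; rewrite expr2; lra.
have -> : (q - 1) * (n * l) = (1 - n) * l - n * l by rewrite -qn; ring.
rewrite jE; lra.
Qed.

(** If l is infinite the bound is trivial; otherwise finiteness of j and t makes all terms real. *)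
Lemma ereal_quadratic_variation (R : realType) (j t b p l : \bar R) (n : R) :
  (0 <= n <= 1)%R -> (0 <= p -> 0 <= l -> 0 <= b -> 0 <= t ->
  j < +oo -> t < +oo -> j = p + 2%:E * (n%:E * l) + b ->
  (forall al be : R, (0 <= al)%R -> (0 <= be)%R -> (al * (1 - n) + be = 1)%R ->
    j <= (al ^+ 2)%:E * p + (al * be * 2)%:E * l + (be ^+ 2)%:E * t) ->
  (forall al be : R, (0 <= al)%R -> (0 <= be)%R -> (al * (1 - n) + be * n = 1)%R ->
    j <= (al ^+ 2)%:E * p + (al * be * 2)%:E * (n%:E * l) + (be ^+ 2)%:E * b) ->
  j <= l + n%:E * t)%E.
Proof.
move=> /andP[n0 n1].
case: l => [l| |] //; last first.
  move=> _ _ _ t0 _ _ _ _ _; rewrite addye ?leey//.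
  have : (0 <= n%:E * t)%E by rewrite mule_ge0.
  by case: (n%:E * t)%E.
case: t => [t| |] // p0 l0 b0 t0 jfin _ jE.
have j0 : (0 <= j)%E by rewrite jE !adde_ge0// !mule_ge0.
have nl0 : (0 <= 2%:E * (n%:E * l%:E))%E by rewrite !mule_ge0.
have pj : (p <= j)%E by rewrite jE -addeA leeDl// adde_ge0.
have bj : (b <= j)%E by rewrite jE leeDr// adde_ge0.
have := le_lt_trans pj jfin; have := le_lt_trans bj jfin.
move: p0 b0 j0 jE {pj bj} jfin.
case: p => [p| |] //; case: b => [b| |] //; case: j => [j| |] //.
rewrite !lee_fin in l0 t0 * => p0 b0 j0 /= jE _ _ _ h1 h2.
move: jE; rewrite -!EFinM -!EFinD => -[jE].
apply: (@quadratic_variation _ j t b p) => //.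
Qed.

Section Variation.
Context {R : realType} {K : closedFieldType} (v : absolute_value R K).
Hypothesis v_nonarch : nonarchimedean_abs v.
Hypothesis v_nontrivial : nontrivial_abs v.
Local Notation g := (@chordal_kernel R K v).
Hypothesis gE : chordal_extension g.
Local Notation P1 := (berkP1 v).
Local Notation X := (borelP1 v).
Local Notation meas := {measure set X -> \bar R}.

Lemma energy_le_robin (S0 : P1) (E : set P1) (mu : meas) : mu setT = 1%E ->
  radon mu -> msupport mu `<=` E -> (energy S0 mu <= robin S0 E)%E.
Proof.
move=> mu1 rmu smu; apply: ereal_sup_ubound.
by exists (mass_one_probability mu1).
Qed.

Variables (S0 : P1) (M : R).
Local Notation gap := (log_gap S0 M).
Local Notation J := (gap_energy S0 M).
Local Open Scope ereal_scope.

Let gap_ge0 x y : 0 <= gap x y := log_gap_ge0 S0 M x y.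
Let mgap x : measurable_fun setT (gap x : X -> \bar R) :=
  measurable_log_gap v_nonarch v_nontrivial gE S0 M x.

Lemma eq_gap_energy (mu mu' : meas) :
  (forall A, measurable A -> mu A = mu' A) -> J mu = J mu'.
Proof.
move=> e; rewrite /gap_energy.
transitivity (\int[mu]_x gap_potential S0 M mu' x).
  apply: eq_integral => x _; rewrite /gap_potential.
  by apply: eq_measure_integral => A mA _; exact: e.
by apply: eq_measure_integral => A mA _; exact: e.
Qed.

Variables (Y B : set P1) (a : P1).
Hypotheses (mY : measurable (Y : set X)) (mB : measurable (B : set X)).
Hypothesis gap_sep : forall x y, Y x -> ~ B x -> Y y -> B y -> gap x y = gap x a.
Let mCB : measurable (~` B : set X) := measurableC mB.

(** By [gap_sep] the gap between an outer and an inner point is that of the outer point to [a], so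
    each mixed iterated integral is the inner mass times one outer integral. *)
Lemma gap_energy_mix (out inn : meas) (al be : {nonneg R}) :
  out setT < +oo -> inn setT < +oo ->
  out (~` (Y `&` ~` B)) = 0 -> inn (~` (Y `&` B)) = 0 ->
  J (mix al be out inn) = (al%:num ^+ 2)%:E * J out +
  (al%:num * be%:num * 2)%:E * (inn setT * \int[out]_x gap x a) +
  (be%:num ^+ 2)%:E * J inn.
Proof.
move=> fout finn out0 inn0.
have mO : measurable (Y `&` ~` B : set X) by exact: measurableI.
have mI : measurable (Y `&` B : set X) by exact: measurableI.
have mgapa : measurable_fun setT ((fun x => gap x a) : X -> \bar R).
  rewrite (_ : (fun x => gap x a) = gap a); first exact: mgap.
  by apply/funext => x; rewrite (log_gapC v_nonarch v_nontrivial gE).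
have pot0 (m : meas) x : 0 <= gap_potential S0 M m x by exact: gap_potential_ge0.
have mpot (m : meas) : m setT < +oo ->
    measurable_fun setT (gap_potential S0 M m : X -> \bar R).
  by move=> fm; exact: (measurable_gap_potential v_nonarch v_nontrivial gE).
have mout := mpot _ fout; have minn := mpot _ finn.
have potmix x : gap_potential S0 M (mix al be out inn) x =
    al%:num%:E * gap_potential S0 M out x + be%:num%:E * gap_potential S0 M inn x.
  by rewrite /gap_potential integral_mix.
have intmix (m : meas) :
    \int[m]_x gap_potential S0 M (mix al be out inn) x =
    al%:num%:E * \int[m]_x gap_potential S0 M out x +
    be%:num%:E * \int[m]_x gap_potential S0 M inn x.
  under eq_integral do rewrite potmix.
  rewrite ge0_integralD//; first last.
  - exact: measurable_funeM.
  - by move=> x _; rewrite mule_ge0.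
  - exact: measurable_funeM.
  - by move=> x _; rewrite mule_ge0.
  by rewrite !ge0_integralZl.
have mpotmix : measurable_fun setT
    (gap_potential S0 M (mix al be out inn) : X -> \bar R).
  rewrite (_ : gap_potential _ _ _ = fun x => al%:num%:E * gap_potential S0 M out x +
    be%:num%:E * gap_potential S0 M inn x); last exact/funext.
  by apply: emeasurable_funD; exact: measurable_funeM.
set L := \int[out]_x gap x a.
have LE : \int[out]_x gap_potential S0 M inn x = inn setT * L.
  rewrite -ge0_integralZl//.
  apply: (eq_integral_null mO out0) => x [Yx nBx].
  rewrite /gap_potential muleC -integral_cst//.
  by apply: (eq_integral_null mI inn0) => y [Yy By]; exact: gap_sep.
have LE' : \int[inn]_x gap_potential S0 M out x = inn setT * L.
  transitivity (\int[inn]_x cst L x); last by rewrite integral_cst// muleC.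
  apply: (eq_integral_null mI inn0) => x [Yx Bx].
  apply: (eq_integral_null mO out0) => y [Yy nBy].
  by rewrite (log_gapC v_nonarch v_nontrivial gE) gap_sep.
rewrite {1}/gap_energy integral_mix// !intmix LE LE' -/(J out) -/(J inn).
have L0 : 0 <= L by apply: integral_ge0.
have TL0 : 0 <= inn setT * L by rewrite mule_ge0.
have Jpos (m : meas) : 0 <= J m by apply: integral_ge0 => x _.
move: TL0 (Jpos out) (Jpos inn).
move: (inn setT * L) (J out) (J inn) => z p q z0 p0 q0.
rewrite !ge0_muleDr ?mule_ge0// !muleA -!EFinM.
have poly (x y : R) : (0 <= x)%R -> (0 <= y)%R ->
    (x * x)%:E * p + (x * y)%:E * z + ((y * x)%:E * z + (y * y)%:E * q) =
    (x ^+ 2)%:E * p + (x * y * 2)%:E * z + (y ^+ 2)%:E * q.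
  move=> x0 y0; rewrite !expr2 (mulrC y x) addeA.
  rewrite -[X in X + _ = _]addeA -ge0_muleDl ?lee_fin ?mulr_ge0// -EFinD.
  by have -> : (x * y + x * y = x * y * 2)%R by ring.
exact: poly.
Qed.

Variables (E : set P1) (nu : probability X R).
Hypothesis hausP1 : hausdorff_space P1.
Hypothesis EY : E `<=` Y.
Hypothesis cY : closed Y.
Hypothesis Y_pos : forall x, Y x -> (0 < g x S0)%R.
Hypothesis Y_le : forall x y, Y x -> Y y ->
  (g x y <= expR M * (g x S0 * g y S0))%R.
Hypothesis nu_eq : equilibrium S0 E nu.
Hypothesis nu_fin : J nu < +oo.

Lemma radon_null_off (mu : meas) : radon mu -> msupport mu `<=` E ->
  mu (~` Y) = 0.
Proof.
move=> rmu smu; apply: (radon_null hausP1 rmu smu); first exact: closed_openC.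
by move=> x nYx /EY.
Qed.

(** On E the energy is M minus the gap energy, so maximal energy means minimal gap energy. *)
Lemma gap_energy_min (mu : meas) : mu setT = 1 -> radon mu ->
  msupport mu `<=` E -> J nu <= J mu.
Proof.
move=> mu1 rmu smu.
have [rnu snu nuV] := nu_eq.
have := @energy_le_robin S0 E _ mu1 rmu smu; rewrite -nuV.
have en := energyE v_nonarch v_nontrivial gE Y_pos Y_le mY.
rewrite (en mu mu1 (radon_null_off rmu smu)).
rewrite (en nu (probability_setT nu) (radon_null_off rnu snu)).
have := nu_fin; have : 0 <= J nu.
  by apply: integral_ge0 => x _; exact: gap_potential_ge0.
have : 0 <= J mu.
  by apply: integral_ge0 => x _; exact: gap_potential_ge0.
case: (J mu) => [p| |]; case: (J nu) => [q| |] //= _ _ _.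
  by rewrite -!EFinB !lee_fin; lra.
Qed.

(* The competitors are nu|_out + nu(B) tau and (1 - s) nu|_out + c nu|_B. *)
Lemma gap_energy_variation (tau : meas) : tau setT = 1 -> radon tau ->
  msupport tau `<=` E -> tau (~` B) = 0 -> J tau < +oo ->
  J nu <= \int[nu]_(x in ~` B) gap x a + nu B * J tau.
Proof.
move=> tau1 rtau stau tauB ftau.
have [rnu snu _] := nu_eq.
have nu1 := probability_setT nu.
have fnu : nu setT < +oo by rewrite nu1 ltry.
have ftauT : tau setT < +oo by rewrite tau1 ltry.
have nuY := radon_null_off rnu snu.
have mYc : measurable (~` Y : set X) by exact: measurableC.
have restrY (D : set X) (mD : measurable D) : mrestr nu mD (~` (Y `&` D)) = 0.
  rewrite /mrestr; apply: (@subset_measure0 _ _ _ nu _ (~` Y)) => //.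
  - by apply: measurableI => //; apply: measurableC; exact: measurableI.
  - by move=> x [nYD Dx] Yx; apply: nYD.
have tauYB : tau (~` (Y `&` B)) = 0.
  rewrite setCI measureU0//; exact: radon_null_off.
have restr (D : set X) (mD : measurable D) : exists m : meas,
    [/\ forall A, m A = nu (A `&` D), radon m /\ msupport m `<=` E,
        m (~` (Y `&` D)) = 0 & forall f, measurable_fun setT f ->
        (forall x, 0 <= f x) -> \int[m]_x f x = \int[nu]_(x in D) f x].
  exists (mrestr nu mD); split => //.
  - by split; [exact: radon_mrestr|exact: msupport_mrestr].
  - exact: restrY.
  - by move=> f; exact: integral_mrestr.
have [out [outE [rout sout] outY intout]] := restr _ mCB.
have [inn [innE [rinn sinn] innY _]] := restr _ mB.
have outT : out setT = 1 - nu B by rewrite outE setTI; exact: probability_setC.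
have innT : inn setT = nu B by rewrite innE setTI.
have nB1 : nu B <= 1 by exact: probability_le1.
have fB : nu B \is a fin_num.
  by rewrite ge0_fin_numE//; apply: le_lt_trans nB1 _; rewrite ltry.
have finn : inn setT < +oo by rewrite innT -ge0_fin_numE.
have fout : out setT < +oo.
  by rewrite outE setTI; apply: le_lt_trans fnu; rewrite le_measure ?inE.
have mgapa : measurable_fun setT ((fun x => gap x a) : X -> \bar R).
  rewrite (_ : (fun x => gap x a) = gap a); first exact: mgap.
  by apply/funext => x; rewrite (log_gapC v_nonarch v_nontrivial gE).
rewrite -intout//.
have one : (0 <= 1 :> R)%R by [].
(* nu is the mix of its two restrictions with both coefficients 1. The inner restriction has mass
   [nu B], whence that factor in the cross term. *)
have nuE : J nu = J out + 2%:E * (nu B * \int[out]_x gap x a) + J inn.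
  rewrite (eq_gap_energy (mu' := mix (NngNum one) (NngNum one) out inn)).
    by rewrite gap_energy_mix// innT /= !mul1r expr1n !mul1e.
  move=> D mD; rewrite mixE /= !mul1e outE innE -measureU; last 3 first.
  - exact: measurableI.
  - exact: measurableI.
  - by rewrite setIACA setICl !setI0.
  by rewrite -setIUr setUC setUv setIT.
have Jmix (al be : R) (m : meas) : (0 <= al)%R -> (0 <= be)%R ->
    m setT < +oo -> radon m -> msupport m `<=` E -> m (~` (Y `&` B)) = 0 ->
    al%:E * (1 - nu B) + be%:E * m setT = 1 ->
    J nu <= (al ^+ 2)%:E * J out +
      (al * be * 2)%:E * (m setT * \int[out]_x gap x a) + (be ^+ 2)%:E * J m.
  move=> al0 be0 fm rm sm mYB mass.
  have := gap_energy_mix (NngNum al0) (NngNum be0) fout fm outY mYB.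
  rewrite /= => <-; apply: gap_energy_min.
  - by rewrite mixE outT.
  - exact: radon_mix.
  - exact: msupport_mix.
have Jpos (m : meas) : 0 <= J m.
  by apply: integral_ge0 => x _; exact: gap_potential_ge0.
have h1 (al be : R) : (0 <= al)%R -> (0 <= be)%R ->
    al%:E * (1 - nu B) + be%:E = 1 -> J nu <= (al ^+ 2)%:E * J out +
    (al * be * 2)%:E * \int[out]_x gap x a + (be ^+ 2)%:E * J tau.
  move=> al0 be0 e; have := Jmix al be tau al0 be0 ftauT rtau stau tauYB.
  by rewrite tau1 mule1 mul1e; exact.
have h2 (al be : R) : (0 <= al)%R -> (0 <= be)%R ->
    al%:E * (1 - nu B) + be%:E * nu B = 1 -> J nu <= (al ^+ 2)%:E * J out +
    (al * be * 2)%:E * (nu B * \int[out]_x gap x a) + (be ^+ 2)%:E * J inn.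
  move=> al0 be0 e; have := Jmix al be inn al0 be0 finn rinn sinn innY.
  by rewrite innT; exact.
have L0 : 0 <= \int[out]_x gap x a by apply: integral_ge0.
move: nuE h1 h2 L0 (Jpos out) (Jpos inn) (Jpos tau) nu_fin ftau.
have nB0 : 0 <= nu B by exact: measure_ge0.
move: nB1 nB0; rewrite -(fineK fB).
move: (fine (nu B)) (\int[out]_x gap x a) (J out) (J inn) (J nu) (J tau).
move=> n L p b j t; rewrite !lee_fin => n1 n0 jE h1 h2 L0 p0 b0 t0 jfin tfin.
apply: (@ereal_quadratic_variation _ j t b p L n) => //; first by rewrite n0.
- move=> al be al0 be0 e; apply: h1 => //.
  by rewrite -EFinB -EFinM -EFinD e.
- move=> al be al0 be0 e; apply: h2 => //.
  by rewrite -EFinB -!EFinM -EFinD e.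
Qed.

End Variation.

(** * Test measures from capacity density *)

Section TestMeasures.
Context {R : realType} {K : closedFieldType} (v : absolute_value R K).
Hypothesis v_nonarch : nonarchimedean_abs v.
Hypothesis v_nontrivial : nontrivial_abs v.
Local Notation g := (@chordal_kernel R K v).
Hypothesis gE : chordal_extension g.
Local Notation P1 := (berkP1 v).
Local Notation X := (borelP1 v).
Local Notation meas := {measure set X -> \bar R}.
Local Notation oo := (binfty v).

Let g0 x y : 0 <= g x y := ker_ge0 v_nonarch v_nontrivial gE x y.
Let g1 x y : g x y <= 1 := ker_le1 v_nonarch v_nontrivial gE x y.
Let gC x y : g x y = g y x := kerC v_nonarch v_nontrivial gE x y.
Let hausP1 : hausdorff_space P1 := berkP1_hausdorff v_nonarch v_nontrivial gE.
Let iso x y z : g x y < g y z -> g x z = g y z :=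
  @ker_isosceles _ _ _ v_nonarch v_nontrivial gE x y z.

Lemma energy_le (S : P1) (Y : set P1) (M : R) (tau : meas) :
  measurable (Y : set X) -> tau setT = 1%E -> tau (~` Y) = 0%E ->
  (forall x, Y x -> 0 < g x S) ->
  (forall x y, Y x -> Y y -> g x y <= expR M * (g x S * g y S)) ->
  (energy S tau <= M%:E)%E.
Proof.
move=> mY tau1 tauY Y0 YM.
rewrite (energyE v_nonarch v_nontrivial gE Y0 YM mY)//.
have : (0 <= gap_energy S M tau)%E.
  by apply: integral_ge0 => x _; exact: gap_potential_ge0.
case: (gap_energy S M tau) => [j| |] //= j0; last by rewrite leNye.
by move: j0; rewrite -EFinB !lee_fin; lra.
Qed.

(** The two kernels have the same numerator, so comparing denominators changes the base point at the
    cost of an additive constant. *)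
Lemma energy_le_add (S S' : P1) (Y : set P1) (M M' c : R) (tau : meas) :
  measurable (Y : set X) -> tau setT = 1%E -> tau (~` Y) = 0%E ->
  (forall x, Y x -> 0 < g x S) -> (forall x, Y x -> 0 < g x S') ->
  (forall x y, Y x -> Y y -> g x y <= expR M * (g x S * g y S)) ->
  (forall x y, Y x -> Y y -> g x y <= expR M' * (g x S' * g y S')) ->
  (forall x y, Y x -> Y y ->
    expR c * (g x S * g y S) <= g x S' * g y S') ->
  (energy S' tau + c%:E <= energy S tau)%E.
Proof.
move=> mY tau1 tauY Y0 Y0' YM YM' h.
(* Raising the truncation level to N makes the shift d nonnegative, so the comparison survives
   truncation at 0. *)
pose N := Num.max M (M' + c).
have YN x y : Y x -> Y y -> g x y <= expR N * (g x S * g y S).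
  move=> Yx Yy; apply: le_trans (YM x y Yx Yy) _.
  rewrite ler_pM2r ?mulr_gt0 ?Y0// ler_expR.
  by rewrite /N le_max lexx.
pose d := N - M' - c.
have d0 : 0 <= d by rewrite /d -addrA -opprD subr_ge0 /N le_max lexx orbT.
have fT : (tau setT < +oo)%E by rewrite tau1 ltry.
have gap_le x y : Y x -> Y y -> (log_gap S N x y <= log_gap S' M' x y + d%:E)%E.
  move=> Yx Yy; rewrite /log_gap.
  have p0 : 0 < g x S * g y S by rewrite mulr_gt0 ?Y0.
  have p0' : 0 < g x S' * g y S' by rewrite mulr_gt0 ?Y0'.
  rewrite (gt_eqF p0) (gt_eqF p0'); have [xy|xy] := eqVneq (g x y) 0.
    by rewrite addye// leey.
  rewrite -EFinD lee_fin.
  have xy0 : 0 < g x y by rewrite lt_def xy g0.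
  rewrite ge_max; apply/andP; split; first by rewrite addr_ge0// le_max lexx.
  have : M' - ln (g x y / (g x S' * g y S')) <=
      Num.max 0 (M' - ln (g x y / (g x S' * g y S'))) by rewrite le_max lexx orbT.
  have : ln (g x y / (g x S' * g y S')) + c <= ln (g x y / (g x S * g y S)).
    rewrite -ler_expR expRD !lnK ?posrE ?divr_gt0//.
    rewrite [leLHS]mulrAC ler_pdivrMr// [leRHS]mulrAC ler_pdivlMr//.
    by rewrite -[leLHS]mulrA ler_pM2l// h.
  by rewrite /d; lra.
have mgap T L x : measurable_fun setT (log_gap T L x : X -> \bar R).
  exact: (measurable_log_gap v_nonarch v_nontrivial gE).
have mpot T L : measurable_fun setT (gap_potential T L tau : X -> \bar R).
  exact: (measurable_gap_potential v_nonarch v_nontrivial gE).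
have pot_le x : Y x -> (gap_potential S N tau x <= gap_potential S' M' tau x + d%:E)%E.
  move=> Yx; rewrite -[d%:E]mule1 -tau1 -integral_cst// -ge0_integralD//.
  - apply: (ge0_le_integral_null mY tauY) => [y|y|y Yy].
    + exact: log_gap_ge0.
    + by rewrite adde_ge0// log_gap_ge0.
    + exact: gap_le.
  - by move=> y _; exact: log_gap_ge0.
have J_le : (gap_energy S N tau <= gap_energy S' M' tau + d%:E)%E.
  rewrite -[d%:E]mule1 -tau1 -integral_cst// -ge0_integralD//.
  - apply: (ge0_le_integral_null mY tauY) => [y|y|y Yy].
    + exact: gap_potential_ge0.
    + by rewrite adde_ge0// gap_potential_ge0.
    + exact: pot_le.
  - by move=> y _; exact: gap_potential_ge0.
rewrite (energyE v_nonarch v_nontrivial gE Y0 YN mY)//.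
rewrite (energyE v_nonarch v_nontrivial gE Y0' YM' mY)//.
move: J_le.
have : (0 <= gap_energy S N tau)%E.
  by apply: integral_ge0 => x _; exact: gap_potential_ge0.
have : (0 <= gap_energy S' M' tau)%E.
  by apply: integral_ge0 => x _; exact: gap_potential_ge0.
move: (gap_energy S N tau) (gap_energy S' M' tau).
case=> [p| |] [q| |] //= _ _; rewrite -?EFinD -?EFinB ?lee_fin /d.
  lra.
by rewrite addeNy addNye leNye.
Qed.

Lemma capacity_witness (S : P1) (F : set P1) (b c : R) : 0 < b -> b < c ->
  (c%:E <= capacity S F)%E -> exists tau : probability X R,
  [/\ radon tau, msupport tau `<=` F & ((ln b)%:E <= energy S tau)%E].
Proof.
move=> b0 bc cF.
have : ((ln b)%:E < robin S F)%E.
  move: cF; rewrite /capacity; case: (robin S F) => [r| |] /=.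
  - by rewrite lee_fin lte_fin => h; rewrite -ltr_expR lnK// (lt_le_trans bc).
  - by rewrite ltry.
  - by rewrite lee_fin leNgt (lt_trans b0 bc).
move=> /ereal_sup_gt[_ [tau [rtau stau] <-] /ltW h].
by exists tau.
Qed.

(** With M equal to the logarithm of the diagonal kernel at z, the gap vanishes there and the energy
    is M. *)
Lemma energy_dirac (S z : P1) : 0 < g z S -> 0 < g z z ->
  energy S (dirac (z : X) : meas) = (ln (g z z / (g z S * g z S)))%:E.
Proof.
move=> zS zz.
pose Y := [set z].
have cY : closed Y by apply: compact_closed => //; exact: compact_set1.
have mY : measurable (Y : set X) by exact: closed_measurableP1.
have p0 : 0 < g z S * g z S by rewrite mulr_gt0.
pose M := ln (g z z / (g z S * g z S)).
have Y0 x : Y x -> 0 < g x S by move=> ->.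
have YM x y : Y x -> Y y -> g x y <= expR M * (g x S * g y S).
  by move=> -> ->; rewrite /M lnK ?posrE ?divr_gt0// divfK// gt_eqF.
have T1 : (dirac (z : X) : meas) setT = 1%E by rewrite /= diracT.
have mpot : measurable_fun setT (gap_potential S M (dirac (z : X) : meas) : X -> \bar R).
  by apply: (measurable_gap_potential v_nonarch v_nontrivial gE); rewrite T1 ltry.
have mgap : measurable_fun setT (log_gap S M z : X -> \bar R).
  exact: (measurable_log_gap v_nonarch v_nontrivial gE).
rewrite (energyE v_nonarch v_nontrivial gE Y0 YM mY)//; last first.
  by rewrite /= diracE memNset// => /(_ erefl).
rewrite /gap_energy integral_dirac// diracT mul1e /gap_potential integral_dirac//.
rewrite diracT mul1e /log_gap gt_eqF// gt_eqF// subrr maxxx.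
by rewrite oppe0 adde0.
Qed.

Variables (E : set P1) (S0 : P1) (rho c : R).
Hypothesis E_compact : compact E.
Hypothesis rho0 : 0 < rho.
Hypothesis rhoE : forall x, E x -> rho <= g x S0.
Hypothesis c0 : 0 < c.
Hypothesis c1 : c < 1.
Hypothesis E_dense : forall (S : P1) (r : R), E S -> S <> oo ->
  (diam S < r%:E)%E -> (r%:E < diam_infty E)%E ->
  ((c * r)%:E <= capacity oo (E `&` berk_ball S r))%E.

Let goo x : x <> oo -> 0 < g x oo.
Proof. exact: (ker_gt0 v_nonarch v_nontrivial gE). Qed.

Let ker_level_closed y (r : R) : closed [set x : P1 | r <= g x y].
Proof.
apply: closed_le_continuous; first exact: cst_continuous.
exact: (ker_continuousl gE).
Qed.

Lemma ker_ball_closed y (r : R) : closed [set x : P1 | g x y <= r].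
Proof.
apply: closed_le_continuous; last exact: cst_continuous.
exact: (ker_continuousl gE).
Qed.

(** Density is stated for the kernel at oo and is transferred to [S0]. On the ball, [g x S0] is
    constant since d < rho, and [g x oo] is at least gam, whence the two logarithmic corrections;
    the factor 1/2 leaves room below the supremum defining the capacity. *)
Lemma local_witness (z a : P1) (r gam d : R) : E z -> z <> oo ->
  (diam z < r%:E)%E -> (r%:E < diam_infty E)%E -> 0 < r -> 0 < gam ->
  E a -> d < rho ->
  (forall x, E x -> berk_ball z r x -> gam <= g x oo /\ g x a <= d) ->
  exists tau : probability X R, [/\ radon tau,
    msupport tau `<=` E `&` berk_ball z r &
    ((ln (c * r / 2) + 2 * ln gam - 2 * ln (g a S0))%:E <= energy S0 tau)%E].
Proof.
move=> Ez zoo zr rE r0 gam0 Ea drho bz.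
have cap := E_dense Ez zoo zr rE.
have cr2 : 0 < c * r / 2 by rewrite divr_gt0// mulr_gt0.
have cr2' : c * r / 2 < c * r.
  by rewrite ltr_pdivrMr// ltr_pMr ?mulr_gt0// ltr1n.
have [tau [rtau stau en]] := capacity_witness cr2 cr2' cap.
exists tau; split; [exact: rtau|exact: stau|].
pose Y := [set x : P1 | gam <= g x oo] `&` [set x | g x a <= d].
have cY : closed Y by apply: closedI; [exact: ker_level_closed|exact: ker_ball_closed].
have mY : measurable (Y : set X) by exact: closed_measurableP1.
have tauY : tau (~` Y) = 0%E.
  apply: (radon_null hausP1 rtau stau); first exact: closed_openC.
  by move=> x nYx [Ex bx]; apply: nYx; exact: bz.
have s0 : 0 < g a S0 by apply: lt_le_trans rho0 (rhoE Ea).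
have Ys x : Y x -> g x S0 = g a S0.
  move=> [_ /= xa]; apply: iso; rewrite (le_lt_trans xa)//.
  exact: lt_le_trans drho (rhoE Ea).
have Yoo x : Y x -> 0 < g x oo by move=> [/= h _]; exact: lt_le_trans h.
have Y0 x : Y x -> 0 < g x S0 by move=> /Ys ->.
have exp2 (p : R) : 0 < p -> expR (2 * ln p) = p * p.
  by move=> p0; rewrite mulr_natl mulr2n expRD lnK.
have gam_le x y : Y x -> Y y -> gam * gam <= g x oo * g y oo.
  by move=> [/= hx _] [/= hy _]; apply: ler_pM => //; exact: ltW.
have le0 x y : Y x -> Y y -> g x y <= expR (- (2 * ln (g a S0))) * (g x S0 * g y S0).
  move=> Yx Yy; rewrite (Ys x Yx) (Ys y Yy) expRN exp2// mulVf//.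
  by rewrite gt_eqF// mulr_gt0.
have leoo x y : Y x -> Y y -> g x y <= expR (- (2 * ln gam)) * (g x oo * g y oo).
  move=> Yx Yy; rewrite expRN exp2// mulrC ler_pdivlMr ?mulr_gt0//.
  apply: le_trans (gam_le x y Yx Yy).
  by apply: ler_piMl => //; rewrite mulr_ge0// ltW.
have cmp x y : Y x -> Y y -> expR (2 * ln gam - 2 * ln (g a S0)) *
    (g x S0 * g y S0) <= g x oo * g y oo.
  move=> Yx Yy; rewrite (Ys x Yx) (Ys y Yy) expRD expRN !exp2//.
  rewrite divfK; last by rewrite gt_eqF// mulr_gt0.
  exact: gam_le.
have := energy_le_add mY (probability_setT tau) tauY Y0 Yoo le0 leoo cmp.
move=> /(le_trans (leeD2r _ en)).
by rewrite -EFinD addrA.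
Qed.

Lemma witness_without_infty : ~ E oo -> (0 < diam_infty E)%E ->
  exists C d1 : R, [/\ 0 < C, 0 < d1, d1 < rho &
    forall (a : option K) (d : R), E (typeI v a) -> 0 < d <= d1 ->
    exists tau : probability X R, [/\ radon tau,
      msupport tau `<=` E `&` chordal_ball a d &
      ((ln d - C - 2 * ln (g (typeI v a) S0))%:E <= energy S0 tau)%E]].
Proof.
move=> nEoo dE.
have Eoo x : E x -> x <> oo by move=> Ex xoo; apply: nEoo; rewrite -xoo.
have [gam gam0 gamE] := compact_pos_lbound (ker_continuousl gE (y := oo)) E_compact
  (fun x Ex => goo (Eoo x Ex)).
have [D D0 DE] : exists2 D, 0 < D & (D%:E < diam_infty E)%E.
  move: dE; case: (diam_infty E) => [D| |] // D0.
    exists (D / 2); move: D0; rewrite !lte_fin; first by move=> ?; rewrite divr_gt0.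
    by move=> ?; lra.
  by exists 1 => //; rewrite ltry.
(* C absorbs the constants of [local_witness]; [rho / 2] keeps radii below rho and D keeps them in
   the range where density applies. *)
exists (`|- (ln (c / 2) + 2 * ln gam)| + 1), (Num.min (rho / 2) D); split.
- by rewrite ltr_wpDl.
- by rewrite lt_min D0 divr_gt0.
- by rewrite gt_min ltr_pdivrMr// ltr_pMr// ltr1n.
move=> a d Ea /andP[d0]; rewrite le_min => /andP[dr dD].
have drho : d < rho by apply: le_lt_trans dr _; rewrite ltr_pdivrMr// ltr_pMr// ltr1n.
have aoo := Eoo _ Ea.
have diam_a : (diam (typeI v a) < d%:E)%E.
  apply: le_lt_trans (diam_le_hsia v_nonarch v_nontrivial gE aoo) _.
  by rewrite hsiaE ?goo// (ker_typeI_self gE) mul0r lte_fin.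
have dlt : (d%:E < diam_infty E)%E by apply: le_lt_trans DE; rewrite lee_fin.
(* As [g] is at most 1, the kernel at oo dominates the chordal one. *)
have ball x : berk_ball (typeI v a) d x -> g x (typeI v a) <= d.
  move=> [xoo]; rewrite hsiaE ?goo// lee_fin ler_pdivrMr ?mulr_gt0 ?goo// => xa.
  apply: le_trans xa _; apply: ler_piMr; first exact: ltW.
  by rewrite mulr_ile1.
have ballE x : E x -> berk_ball (typeI v a) d x ->
    gam <= g x oo /\ g x (typeI v a) <= d.
  by move=> Ex bx; split; [exact: gamE|exact: ball].
have [tau [rtau stau en]] :=
  local_witness Ea aoo diam_a dlt d0 gam0 Ea drho ballE.
exists tau; split; [exact: rtau| |].
  by move=> x /stau[Ex bx]; split => //; exact: ball.
apply: le_trans en; rewrite lee_fin.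
rewrite (_ : c * d / 2 = (c / 2) * d); last by ring.
have -> : ln (c / 2 * d) = ln (c / 2) + ln d by rewrite lnM ?posrE ?divr_gt0.
have := ler_norm (- (ln (c / 2) + 2 * ln gam)); lra.
Qed.

(** The chordal ball of radius d about z, when it is too small to reach oo, is a ball of radius d /
    g(z, oo)^2 for the kernel at oo. If x were farther from oo than z, [iso] would give g(x, z) =
    g(x, oo), contradicting the bound on g(x, z). *)
Lemma ker_ball_of_hsia z x (d : R) : z <> oo -> x <> oo -> 0 < d ->
  d < g z oo -> (hsia oo x z <= (d / (g z oo * g z oo))%:E)%E ->
  g x oo = g z oo /\ g x z <= d.
Proof.
move=> zoo xoo d0 dz; rewrite hsiaE ?goo// lee_fin.
have z0 := goo zoo; have x0 := goo xoo.
rewrite ler_pdivrMr ?mulr_gt0// => h.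
have {}h : g x z <= d * g x oo / g z oo.
  by apply: le_trans h _; rewrite le_eqVlt; apply/orP; left; apply/eqP; field; rewrite gt_eqF.
have xz : g x oo <= g z oo.
  rewrite leNgt; apply/negP => lt.
  have e : g z x = g oo x by apply: iso; rewrite (gC oo x).
  have : g x z < g x oo.
    apply: le_lt_trans h _; rewrite ltr_pdivrMr// mulrC ltr_pM2l//.
  by rewrite gC e gC ltxx.
have {}h : g x z <= d.
  apply: le_trans h _; rewrite ler_pdivrMr// ler_pM2l//.
by split => //; apply: iso; rewrite (le_lt_trans h).
Qed.

(** No uniform positive lower bound for [g x oo] on E exists now. Away from oo, density is rescaled
    by the local value of g(., oo); at scale d near oo, the test measure is placed at or around a
    finite point of E at distance comparable to d from oo. *)
Lemma witness_with_infty : E oo -> (exists2 x, E x & x <> oo) ->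
  exists C d1 : R, [/\ 0 < C, 0 < d1, d1 < rho &
    forall (a : option K) (d : R), E (typeI v a) -> 0 < d <= d1 ->
    exists tau : probability X R, [/\ radon tau,
      msupport tau `<=` E `&` chordal_ball a d &
      ((ln d - C - 2 * ln (g (typeI v a) S0))%:E <= energy S0 tau)%E]].
Proof.
move=> Eoo [x1 Ex1 x1oo].
have dE : diam_infty E = +oo%E.
  apply/eqP; rewrite eq_le leey /=; apply: ereal_sup_ubound.
  exists oo, oo; split => //; rewrite /hsia.
  by rewrite (_ : g oo oo = 0) ?mul0r ?eqxx//; exact: (ker_typeI_self gE None).
have fin_witness z d : E z -> z <> oo -> 0 < d -> d < g z oo -> d < rho ->
    (diam z < (d / (g z oo * g z oo))%:E)%E ->
    exists tau : probability X R, [/\ radon tau,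
      msupport tau `<=` [set x | [/\ E x, g x oo = g z oo & g x z <= d]] &
      ((ln (c * d / 2) - 2 * ln (g z S0))%:E <= energy S0 tau)%E].
  move=> Ez zoo d0 dz drho zd; have z0 := goo zoo.
  have r0 : 0 < d / (g z oo * g z oo) by rewrite divr_gt0// mulr_gt0.
  have rlt : ((d / (g z oo * g z oo))%:E < diam_infty E)%E by rewrite dE ltry.
  have ballE x : E x -> berk_ball z (d / (g z oo * g z oo)) x ->
      g z oo <= g x oo /\ g x z <= d.
    by move=> Ex [xoo /(ker_ball_of_hsia zoo xoo d0 dz)[-> ?]].
  have [tau [rtau stau en]] := local_witness Ez zoo zd rlt r0 z0 Ez drho ballE.
  exists tau; split; [exact: rtau| |].
    by move=> x /stau[Ex [xoo /(ker_ball_of_hsia zoo xoo d0 dz)[? ?]]].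
  apply: le_trans en; rewrite lee_fin.
  have lnzz : ln (g z oo * g z oo) = ln (g z oo) + ln (g z oo) by rewrite lnM.
  rewrite (_ : c * (d / (g z oo * g z oo)) / 2 = (c * d / 2) / (g z oo * g z oo)).
    have -> : ln (c * d / 2 / (g z oo * g z oo)) = ln (c * d / 2) - ln (g z oo * g z oo).
      by rewrite ln_div ?posrE ?divr_gt0 ?mulr_gt0.
    rewrite lnzz; lra.
  by field; rewrite gt_eqF.
have x10 := goo x1oo.
(* Otherwise the part of E in the ball of radius r = 3 / (c d) about [x1] would satisfy g(x, oo) >=
   d, where the kernel at oo is at most 1/d; density gives capacity at least c r = 3/d. Membership
   in that ball is also what yields c d / 3 <= g(z, oo). *)
have near_infty d : 0 < d -> d <= g x1 oo * g x1 oo ->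
    exists z, [/\ E z, z <> oo, c * d / 3 <= g z oo & g z oo <= d].
  move=> d0 dx1; pose r := 3 / (c * d).
  have cd0 : 0 < c * d by rewrite mulr_gt0.
  have r0 : 0 < r by rewrite divr_gt0.
  have cdd : c * d < d by rewrite gtr_pMl.
  have x1r : (diam x1 < r%:E)%E.
    apply: le_lt_trans (diam_le_hsia v_nonarch v_nontrivial gE x1oo) _.
    rewrite hsiaE// lte_fin ltr_pdivrMr ?mulr_gt0//.
    apply: (le_lt_trans (g1 _ _)); rewrite /r mulrAC ltr_pdivlMr// mul1r.
    lra.
  have rlt : (r%:E < diam_infty E)%E by rewrite dE ltry.
  have cap := E_dense Ex1 x1oo x1r rlt.
  have cr2 : 0 < c * r / 2 by rewrite divr_gt0// mulr_gt0.
  have cr2' : c * r / 2 < c * r by move: (c * r) (mulr_gt0 c0 r0) => p p0; lra.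
  have [tau [rtau stau en]] := capacity_witness cr2 cr2' cap.
  apply: contrapT => nz.
  have far x : E x -> berk_ball x1 r x -> d <= g x oo.
    move=> Ex [xoo xr]; rewrite leNgt; apply/negP => xd.
    apply: nz; exists x; split => //; last exact: ltW.
    have x0 := goo xoo.
    have [xx1|x1x] := ltP (g x oo) (g x1 oo); last first.
      apply: le_trans x1x.
      have : g x1 oo * g x1 oo <= g x1 oo by rewrite ler_piMl// ltW.
      lra.
    have e : g x x1 = g oo x1 by apply: iso; rewrite (gC oo x1).
    move: xr; rewrite hsiaE// e (gC oo x1) lee_fin.
    rewrite ler_pdivrMr ?mulr_gt0// /r => h.
    have {}h : 1 <= 3 / (c * d) * g x oo.
      by move: h; rewrite -[leLHS]mul1r mulrA ler_pM2r.
    by move: h; rewrite mulrAC ler_pdivlMr// mul1r; lra.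
  pose Y := [set x : P1 | d <= g x oo].
  have cY : closed Y by exact: ker_level_closed.
  have tauY : tau (~` Y) = 0%E.
    apply: (radon_null hausP1 rtau stau); first exact: closed_openC.
    by move=> x nYx [Ex bx]; apply: nYx; exact: far.
  have Y0 x : Y x -> 0 < g x oo by move=> h; exact: lt_le_trans h.
  have goo0 : g (typeI v (Some 0)) oo = 1.
    rewrite (ker_typeI gE (Some 0) None) /chordal /= mulr0 mulr1 sub0r.
    by rewrite absvN absv1 absv0 max_r// max_l// mulr1 divr1.
  have Yle x y : Y x -> Y y -> g x y <= expR (- ln d) * (g x oo * g y oo).
    move=> Yx Yy; have x0 := Y0 _ Yx; have y0 := Y0 _ Yy.
    have := hsia_ultra v_nonarch v_nontrivial gE (S0 := oo) (y := typeI v (Some 0)) x0 _ y0.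
    rewrite goo0 mulr1 mul1r => /(_ ltr01) h.
    rewrite expRN lnK// -ler_pdivrMr ?mulr_gt0//; apply: le_trans h _.
    rewrite ge_max; apply/andP; split; rewrite ler_pdivrMr//.
      by rewrite mulrC ler_pdivlMr// (le_trans _ Yx)// ler_piMl// ltW.
    by rewrite mulrC ler_pdivlMr// (le_trans _ Yy)// ler_piMl// ltW.
  have := energy_le (closed_measurableP1 cY) (probability_setT tau) tauY Y0 Yle.
  move=> /(le_trans en); rewrite lee_fin leNgt -lnV ?posrE//.
  rewrite ltr_ln ?posrE ?invr_gt0// => /negP[].
  have -> : c * r / 2 = 3 / 2 / d by rewrite /r; field; rewrite !gt_eqF.
  by rewrite ltr_pMl ?invr_gt0//; lra.
have infty_witness d : 0 < d -> d <= g x1 oo * g x1 oo -> d < rho ->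
    exists tau : probability X R, [/\ radon tau,
      msupport tau `<=` [set x | E x /\ g x oo <= d] &
      ((ln (c * c * d / 12) - 2 * ln (g oo S0))%:E <= energy S0 tau)%E].
  move=> d0 dx1 drho.
  have [z [Ez zoo zl zd]] := near_infty d d0 dx1.
  have z0 := goo zoo.
  have zS : g z S0 = g oo S0.
    by apply: iso; rewrite (le_lt_trans zd)// (lt_le_trans drho)// rhoE.
  (* If g(z, z) is too large for density to apply at chordal radius g(z, oo) / 2, a Dirac mass at z
     has enough energy. Otherwise that radius is at least c d / 6, and the factor c / 2 of
     [fin_witness] produces c^2 d / 12. *)
  have [zz|zz] := leP (g z oo / 2) (g z z).
    have zz0 : 0 < g z z by apply: lt_le_trans zz; rewrite divr_gt0.
    have zS0 : 0 < g z S0 by rewrite (lt_le_trans rho0)// rhoE.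
    exists (dirac (z : X)); split.
    - exact: radon_dirac.
    - move=> x xs.
      suff -> : x = z by [].
      apply: contrapT => xz.
      have := xs (~` [set z]).
      rewrite /= diracE memNset ?ltxx; last by move=> /(_ erefl).
      suff oz : open (~` [set z]) by move=> /(_ oz xz).
      apply: closed_openC; apply: compact_closed => //; exact: compact_set1.
    rewrite energy_dirac// lee_fin.
    have -> : ln (g z z / (g z S0 * g z S0)) = ln (g z z) - 2 * ln (g oo S0).
      by rewrite -zS ln_div ?posrE ?mulr_gt0// lnM ?posrE//; ring.
    suff : ln (c * c * d / 12) <= ln (g z z) by lra.
    rewrite ler_ln ?posrE ?divr_gt0 ?mulr_gt0//.
    have : c * (c * d) <= c * d by rewrite ler_piMl ?mulr_ge0 ?ltW.
    have : 0 < c * d by rewrite mulr_gt0.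
    lra.
  have diam_z : (diam z < (g z oo / 2 / (g z oo * g z oo))%:E)%E.
    apply: le_lt_trans (diam_le_hsia v_nonarch v_nontrivial gE zoo) _.
    by rewrite hsiaE// lte_fin ltr_pM2r// invr_gt0 mulr_gt0.
  have [tau [rtau stau en]] :=
    fin_witness z (g z oo / 2) Ez zoo ltac:(lra) ltac:(lra) ltac:(lra) diam_z.
  exists tau; split; [exact: rtau| |]; first by move=> x /stau[Ex xz _]; split; rewrite ?xz.
  apply: le_trans en; rewrite lee_fin zS lerD2r ler_ln ?posrE ?divr_gt0 ?mulr_gt0 ?divr_gt0//.
  have : c * (c * d / 3) <= c * g z oo by rewrite ler_pM2l.
  lra.
exists (`|- ln (c * c / 12)| + 1), (Num.min (rho / 2) (g x1 oo * g x1 oo)); split.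
- by rewrite ltr_wpDl.
- by rewrite lt_min !mulr_gt0 ?invr_gt0.
- by rewrite gt_min ltr_pdivrMr// ltr_pMr// ltr1n.
move=> a d Ea /andP[d0]; rewrite le_min => /andP[dr dx1].
have drho : d < rho by lra.
have lnle (b : R) : 0 < b -> c * c / 12 <= b ->
    ln d - (`|- ln (c * c / 12)| + 1) <= ln (b * d).
  move=> b0 bb.
  have -> : ln (b * d) = ln b + ln d by rewrite lnM.
  have : ln (c * c / 12) <= ln b by rewrite ler_ln ?posrE// divr_gt0// mulr_gt0.
  have := ler_norm (- ln (c * c / 12)); lra.
(* Either the ball of radius d about a does not reach oo and density is used at a itself, or it
   contains oo and test measures around oo serve for a too. *)
have [daoo|aood] := ltP d (g (typeI v a) oo).
  have aoo : typeI v a <> oo.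
    by move=> e; move: daoo; rewrite e (ker_typeI_self gE None) ltNge ltW.
  have diam_a : (diam (typeI v a) <
      (d / (g (typeI v a) oo * g (typeI v a) oo))%:E)%E.
    apply: le_lt_trans (diam_le_hsia v_nonarch v_nontrivial gE aoo) _.
    by rewrite hsiaE ?goo// (ker_typeI_self gE) mul0r lte_fin divr_gt0// mulr_gt0 ?goo.
  have [tau [rtau stau en]] := fin_witness (typeI v a) d Ea aoo d0 daoo drho diam_a.
  exists tau; split; [exact: rtau| |]; first by move=> x /stau[Ex _ xa].
  apply: le_trans en; rewrite lee_fin lerD2r.
  rewrite (_ : c * d / 2 = (c / 2) * d); last by ring.
  have cc : c * c <= c by rewrite ler_piMl// ltW.
  by apply: lnle; move: c0 cc; lra.
have [tau [rtau stau en]] := infty_witness d d0 dx1 drho.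
have aS : g (typeI v a) S0 = g oo S0.
  by apply: iso; rewrite (le_lt_trans aood)// (lt_le_trans drho)// rhoE.
exists tau; split; [exact: rtau| |].
  move=> x /stau[Ex xd]; split => //; rewrite /chordal_ball /=.
  apply: le_trans (ker_ultra v_nonarch v_nontrivial gE oo _ _) _.
  by rewrite ge_max xd gC.
apply: le_trans en; rewrite lee_fin aS lerD2r.
rewrite (_ : c * c * d / 12 = (c * c / 12) * d); last by ring.
by apply: lnle; rewrite ?divr_gt0 ?mulr_gt0.
Qed.

End TestMeasures.

(** * Decay of the Green potential *)

(* Going from [e d] to [d] multiplies u by at most q = C / (1 + C), so that
   u decays like d to the power - ln q. *)
Lemma holder_decay (R : realType) (C d1 : R) : 0 < C -> 0 < d1 ->
  exists alpha A : R, 0 < alpha /\ forall u n : R -> R,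
    (forall d, 0 < d <= d1 -> 0 <= n d <= 1 /\ u d <= C * n d) ->
    (forall d' d, 0 < d' <= d -> d <= d1 -> n d' * ln (d / d') <= u d - u d') ->
    forall d, 0 < d <= d1 -> u d <= A * d `^ alpha.
Proof.
move=> C0 d10; pose q := C / (1 + C).
have C1 : 0 < 1 + C by rewrite ltr_wpDl.
have q0 : 0 < q by rewrite divr_gt0.
have q1 : q < 1 by rewrite ltr_pdivrMr// mul1r ltrDr.
pose alpha := - ln q.
have alpha0 : 0 < alpha by rewrite oppr_gt0 ln_lt0// q0.
have e_gt0 : 0 < expR 1 :> R := expR_gt0 _.
pose p (d : R) := d `^ alpha.
have p0 d : 0 < d -> 0 < p d by move=> d0; exact: powR_gt0.
have pe d : 0 < d -> q * p (d * expR 1) = p d.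
  move=> d0; rewrite /p powRM ?expR_ge0 ?ltW// -expRM mul1r /alpha expRN lnK//.
  by field; rewrite gt_eqF.
(* Chosen so that on the top scale d1 / e < d <= d1 the trivial bound u <= C, from n <= 1, is
   already at most A d^alpha. *)
pose A := C / (q * p d1).
have A0 : 0 < A by rewrite divr_gt0// mulr_gt0// p0.
(* Both constants precede u and n, so the decay is uniform over boundary points. *)
exists alpha, A; split => // u n uC mono.
have base d : 0 < d <= d1 -> d1 < d * expR 1 -> u d <= A * p d.
  move=> dd1 d1e; have /andP[d0 _] := dd1.
  have [/andP[_ n1] /le_trans->//] := uC d dd1.
  apply: (@le_trans _ _ C); first by rewrite ler_piMr// ltW.
  have : p d1 <= p (d * expR 1).
    by rewrite /p ge0_ler_powR ?nnegrE ?ltW ?mulr_gt0.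
  rewrite -(pe d d0) /A => pp.
  rewrite (_ : C / (q * p d1) * (q * p (d * expR 1)) = C * (p (d * expR 1) / p d1)).
    by apply: ler_peMr; [exact: ltW|rewrite ler_pdivlMr ?p0// mul1r].
  by field; rewrite !gt_eqF// p0.
have step d : 0 < d -> d * expR 1 <= d1 -> u d <= q * u (d * expR 1).
  move=> d0 de.
  have dle : d <= d * expR 1 by rewrite ler_peMr ?ltW// expR_gt1.
  have dd1 : 0 < d <= d1 by rewrite d0 (le_trans dle).
  have [_ h] := uC d dd1.
  have := mono d (d * expR 1); rewrite d0 dle => /(_ isT de).
  rewrite mulrAC divff ?gt_eqF// mul1r expRK mulr1 => nu.
  have : u d <= C * (u (d * expR 1) - u d).
    by apply: le_trans h _; rewrite ler_pM2l.
  by rewrite /q mulrAC ler_pdivlMr//; lra.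
have main k d : 0 < d <= d1 -> d1 < d * expR 1 ^+ k.+1 -> u d <= A * p d.
  elim: k d => [|k IH] d dd1; first by rewrite expr1; exact: base.
  move=> dk; have [/(base d dd1)//|ed] := ltP d1 (d * expR 1).
  have /andP[d0 _] := dd1.
  apply: (le_trans (step d d0 ed)); rewrite -(pe d d0) mulrCA ler_pM2l//.
  by apply: IH; rewrite ?mulr_gt0// -mulrA -exprS.
move=> d dd1; have /andP[d0 _] := dd1.
(* The top scale is reached within this many steps, since e^k >= 1 + k. *)
apply: (main (Num.bound (d1 / d))) => //.
rewrite mulrC -ltr_pdivrMr//; apply: lt_le_trans (archi_boundP _) _.
  by rewrite divr_ge0// ltW.
rewrite -expRM_natl mulr1; apply: le_trans (expR_ge1Dx _).
by rewrite -natr1; lra.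
Qed.

Section HolderBound.
Context {R : realType} {K : closedFieldType} (v : absolute_value R K).
Hypothesis v_nonarch : nonarchimedean_abs v.
Hypothesis v_nontrivial : nontrivial_abs v.
Local Notation g := (@chordal_kernel R K v).
Hypothesis gE : chordal_extension g.
Local Notation P1 := (berkP1 v).
Local Notation X := (borelP1 v).
Local Notation meas := {measure set X -> \bar R}.
Local Notation oo := (binfty v).

Let g0 x y : 0 <= g x y := ker_ge0 v_nonarch v_nontrivial gE x y.
Let g1 x y : g x y <= 1 := ker_le1 v_nonarch v_nontrivial gE x y.
Let gC x y : g x y = g y x := kerC v_nonarch v_nontrivial gE x y.
Let hausP1 : hausdorff_space P1 := berkP1_hausdorff v_nonarch v_nontrivial gE.
Let iso x y z : g x y < g y z -> g x z = g y z :=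
  @ker_isosceles _ _ _ v_nonarch v_nontrivial gE x y z.

Variables (E : set P1) (S0 : P1) (nu : probability X R).
Hypothesis E_compact : compact E.
Hypothesis nu_eq : equilibrium S0 E nu.

Lemma radon_support_nonempty : E !=set0.
Proof.
have [rnu snu _] := nu_eq; apply: contrapT => E0.
have : nu setT = 0%E.
  apply: (radon_null hausP1 rnu snu); first exact: openT.
  by move=> x _ Ex; apply: E0; exists x.
by rewrite probability_setT => /eqP; rewrite onee_eq0.
Qed.

Hypothesis S0_notin_E : ~ E S0.
Hypothesis V_gtNy : (-oo < robin S0 E)%E.

(** If the kernel vanished on E x E, then E would be one point of zero self-distance, and the energy
    would be -oo. This ensures that density has a nonempty range of radii. *)
Lemma positive_kernel_pair : exists x y, [/\ E x, E y & 0 < g x y].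
Proof.
apply: contrapT => no_pair.
have zero x y : E x -> E y -> g x y = 0.
  move=> Ex Ey; apply/eqP; rewrite eq_le g0 andbT leNgt; apply/negP => xy.
  by apply: no_pair; exists x, y.
have [x0 Ex0] := radon_support_nonempty.
have [rnu snu enu] := nu_eq.
have cY : closed [set x0] by apply: compact_closed => //; exact: compact_set1.
have x0S : 0 < g x0 S0.
  by apply: (ker_gt0 v_nonarch v_nontrivial gE) => e; apply: S0_notin_E; rewrite -e.
have nuY : nu (~` [set x0]) = 0%E.
  apply: (radon_null hausP1 rnu snu); first exact: closed_openC.
  move=> x xx0 Ex; apply: xx0.
  by apply: (ker_eq0 v_nonarch v_nontrivial gE); exact: zero.
have enle M : (robin S0 E <= M%:E)%E.
  rewrite -enu; apply: (energy_le v_nonarch v_nontrivial gE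
    (closed_measurableP1 cY) (probability_setT nu) nuY).
    by move=> x ->.
  by move=> x y -> ->; rewrite zero// !mulr_ge0// expR_ge0.
move: V_gtNy enle; case: (robin S0 E) => [r| |] // _.
  by move=> /(_ (r - 1)); rewrite lee_fin; lra.
by move=> /(_ 0).
Qed.

Hypothesis E_density : lower_capacity_density E.

Lemma test_measures (rho : R) : 0 < rho -> (forall x, E x -> rho <= g x S0) ->
  exists C d1 : R, [/\ 0 < C, 0 < d1, d1 < rho &
    forall (a : option K) (d : R), E (typeI v a) -> 0 < d <= d1 ->
    exists tau : probability X R, [/\ radon tau,
      msupport tau `<=` E `&` chordal_ball a d &
      ((ln d - C - 2 * ln (g (typeI v a) S0))%:E <= energy S0 tau)%E]].
Proof.
move=> rho0 rhoE; have [c [c0 c1 dens]] := E_density.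
have [x [y [Ex Ey xy]]] := positive_kernel_pair.
have [Eoo|nEoo] := pselect (E oo).
  apply: (witness_with_infty v_nonarch v_nontrivial gE rho0 rhoE c0 c1 dens) => //.
  have [xoo|] := pselect (x = oo); last by exists x.
  exists y => // yoo; move: xy; rewrite xoo yoo.
  by rewrite [X in 0 < X](ker_typeI_self gE None) ltxx.
apply: (witness_without_infty v_nonarch v_nontrivial gE E_compact rho0 rhoE c0 dens) => //.
have oo_gt0 z : E z -> 0 < g z oo.
  by move=> Ez; apply: (ker_gt0 v_nonarch v_nontrivial gE) => e; apply: nEoo; rewrite -e.
apply: (@lt_le_trans _ _ (hsia oo x y)).
  by rewrite hsiaE ?oo_gt0// lte_fin divr_gt0// mulr_gt0 ?oo_gt0.
by apply: ereal_sup_ubound; exists x, y.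
Qed.

Variables (rho : R).
Hypotheses (rho0 : 0 < rho) (rhoE : forall x, E x -> rho <= g x S0).

(** On Y the kernel based at [S0] is at most 1 / rho^2 = e^M, so no truncation occurs there. *)
Let M := - (2 * ln rho).
Let Y := [set x : P1 | rho <= g x S0].

Let cY : closed Y.
Proof.
apply: closed_le_continuous; first exact: cst_continuous.
exact: (ker_continuousl gE).
Qed.

Let mY : measurable (Y : set X) := closed_measurableP1 cY.

Let Y_pos x : Y x -> 0 < g x S0.
Proof. exact: lt_le_trans. Qed.

Let Y_le x y : Y x -> Y y -> g x y <= expR M * (g x S0 * g y S0).
Proof.
move=> Yx Yy; rewrite /M expRN mulr_natl mulr2n expRD lnK// mulrC.
rewrite ler_pdivlMr ?mulr_gt0//.
apply: (@le_trans _ _ (rho * rho)).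
  by apply: ler_piMl => //; rewrite mulr_ge0// ltW.
by apply: ler_pM => //; exact: ltW.
Qed.

Let nuY : nu (~` Y) = 0%E.
Proof. by have [rnu snu _] := nu_eq; exact: (radon_null_off hausP1 rhoE cY rnu snu). Qed.

Let J := gap_energy S0 M nu.

Let J_ge0 : (0 <= J)%E.
Proof. by apply: integral_ge0 => x _; exact: gap_potential_ge0. Qed.

Let robinE : robin S0 E = (M%:E - J)%E.
Proof.
have [_ _ <-] := nu_eq.
exact: (energyE v_nonarch v_nontrivial gE Y_pos Y_le mY (probability_setT nu) nuY).
Qed.

Let J_lty : (J < +oo)%E.
Proof.
by move: V_gtNy; rewrite robinE; case: J => [j| |] //=; rewrite ltry.
Qed.

Section Ball.
Variable a : option K.
Local Notation za := (typeI v a).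
Hypothesis Ea : E za.
Local Notation s := (g za S0).
Local Notation B := (@chordal_ball R K v a).

Let s0 : 0 < s := lt_le_trans rho0 (rhoE Ea).

(** The gap M - log(d / s^2) of a pair at chordal distance d inside the ball, where g(., S0) is
    constantly s. *)
Definition ball_gap (d : R) := M - ln d + 2 * ln s.
Definition ball_mass (d : R) := fine (nu (B d)).
Definition outer_gap (d : R) :=
  fine (\int[nu]_(x in Y `&` ~` B d) log_gap S0 M x za)%E.
(** This is the u of the overview: the subtracted terms bound from below the gap potential of nu at
    every point of the ball. *)
Definition gap_excess (d : R) :=
  fine J - outer_gap d - ball_mass d * ball_gap d.

Let mB d : measurable (B d : set X).
Proof. by apply: closed_measurableP1 => x; exact: (ker_ball_closed gE). Qed.

Let mO d : measurable (Y `&` ~` B d : set X).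
Proof. by apply: measurableI; [exact: mY|apply: measurableC; exact: mB]. Qed.

Let mgap x : measurable_fun setT (log_gap S0 M x : X -> \bar R).
Proof. exact: (measurable_log_gap v_nonarch v_nontrivial gE). Qed.

Let mgapr x : measurable_fun setT ((fun y => log_gap S0 M y x) : X -> \bar R).
Proof.
rewrite (_ : (fun y => log_gap S0 M y x) = log_gap S0 M x); first exact: mgap.
by apply/funext => y; rewrite (log_gapC v_nonarch v_nontrivial gE).
Qed.

Let massE d : (ball_mass d)%:E = nu (B d).
Proof.
rewrite /ball_mass fineK// ge0_fin_numE//.
by apply: le_lt_trans (probability_le1 nu (mB d)) _; rewrite ltry.
Qed.

Lemma ball_mass01 d : 0 <= ball_mass d <= 1.
Proof. by rewrite -!lee_fin massE measure_ge0 (probability_le1 nu (mB d)). Qed.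

Let sB d x : d < rho -> B d x -> g x S0 = s.
Proof.
move=> dr Bx; apply: iso; apply: le_lt_trans Bx _; apply: lt_le_trans dr _.
exact: rhoE.
Qed.

Let rho_le1 : rho <= 1 := le_trans (rhoE Ea) (g1 _ _).

Let M_ge0 : 0 <= M + 2 * ln s.
Proof.
have : ln rho <= ln s by rewrite ler_ln ?posrE// rhoE.
rewrite /M; lra.
Qed.

Let ball_gap_ge0 d : 0 < d -> d < rho -> 0 <= ball_gap d.
Proof.
move=> d0 dr; rewrite /ball_gap.
have : ln d <= 0 by rewrite ln_le0// (le_trans (ltW dr)).
have := M_ge0; lra.
Qed.

(** Outside the ball the kernel with the centre is at least d, which makes the outer integral
    finite. *)
Lemma log_gap_le_outer d x : 0 < d -> d < rho -> Y x -> ~ B d x ->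
  (log_gap S0 M x za <= (M - ln d)%:E)%E.
Proof.
move=> d0 dr Yx Bx; have xS := Y_pos Yx.
have dx : d < g x za by rewrite ltNge; apply/negP.
have xa0 : 0 < g x za := lt_trans d0 dx.
rewrite /log_gap mulf_eq0 !gt_eqF//= lee_fin ge_max; apply/andP; split.
  have : ln d <= 0 by rewrite ln_le0// (le_trans (ltW dr)).
  have : ln rho <= 0 by rewrite ln_le0.
  rewrite /M; lra.
rewrite lerD2l lerN2 ler_ln ?posrE ?divr_gt0 ?mulr_gt0//.
apply: (le_trans (ltW dx)); rewrite ler_pdivlMr ?mulr_gt0//.
by apply: ler_piMr; [exact: ltW|rewrite mulr_ile1].
Qed.

Lemma ball_gap_le d x y : 0 < d -> d < rho -> B d x -> B d y ->
  ((ball_gap d)%:E <= log_gap S0 M x y)%E.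
Proof.
move=> d0 dr Bx By.
rewrite /log_gap (sB dr Bx) (sB dr By) mulf_eq0 gt_eqF//=.
have [|xy] := eqVneq (g x y) 0; first by rewrite leey.
have xy0 : 0 < g x y by rewrite lt_def xy g0.
have xyd : g x y <= d.
  apply: le_trans (ker_ultra v_nonarch v_nontrivial gE za _ _) _.
  by rewrite ge_max [X in X && _]Bx gC.
rewrite lee_fin le_max; apply/orP; right.
have -> : ln (g x y / (s * s)) = ln (g x y) - ln (s * s).
  by rewrite ln_div ?posrE ?mulr_gt0.
have -> : ln (s * s) = ln s + ln s by rewrite lnM.
have : ln (g x y) <= ln d by rewrite ler_ln ?posrE.
rewrite /ball_gap; lra.
Qed.

(** y is strictly closer to the centre than x, so the triangle is isosceles. *)
Let gap_sep d x y : d < rho -> Y x -> ~ B d x -> B d y ->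
  log_gap S0 M x y = log_gap S0 M x za.
Proof.
move=> dr Yx Bx By; rewrite /log_gap (sB dr By).
suff -> : g x y = g x za by [].
rewrite gC [RHS]gC; apply: iso; apply: le_lt_trans By _.
by rewrite gC ltNge; apply/negP.
Qed.

Let outerE d : 0 < d -> d < rho -> (outer_gap d)%:E =
  (\int[nu]_(x in Y `&` ~` B d) log_gap S0 M x za)%E.
Proof.
move=> d0 dr; rewrite /outer_gap fineK// ge0_fin_numE; last first.
  by apply: integral_ge0 => x _; exact: log_gap_ge0.
apply: (@le_lt_trans _ _ (\int[nu]_(x in Y `&` ~` B d) (cst (M - ln d)%:E x))%E).
  apply: ge0_le_integral => //.
  - by move=> x _; exact: log_gap_ge0.
  - exact: measurable_funS (mgapr _).
  - by move=> x [Yx Bx]; exact: log_gap_le_outer.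
rewrite integral_cst//.
have fin : nu (Y `&` ~` B d) \is a fin_num.
  by rewrite ge0_fin_numE// (le_lt_trans (probability_le1 nu (mO d)))// ltry.
by rewrite -[X in (_ * X)%E](fineK fin) -EFinM ltry.
Qed.

(** When the ball shrinks, the annulus joins the outer region, and its points still have gap at
    least [ball_gap d] to the centre. *)
Lemma outer_gap_mono d' d : 0 < d' <= d -> d < rho ->
  outer_gap d + (ball_mass d - ball_mass d') * ball_gap d <= outer_gap d'.
Proof.
move=> /andP[d'0 d'd] dr; have d0 := lt_le_trans d'0 d'd.
have d'r := le_lt_trans d'd dr.
pose D := Y `&` (B d `\` B d').
have mD : measurable (D : set X) by apply: measurableI => //; exact: measurableD.
have BB : B d' `<=` B d by move=> x; rewrite /chordal_ball /= => /le_trans; apply.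
rewrite -lee_fin EFinD EFinM EFinB !massE !outerE//.
have -> : Y `&` ~` B d' = (Y `&` ~` B d) `|` D.
  apply/seteqP; split => x.
    by move=> [Yx B'x]; have [Bx|nBx] := pselect (B d x); [right|left].
  by move=> [[Yx nBx]|[Yx [_ nB'x]]]; split => // /BB.
rewrite ge0_integral_setU//; last first.
- by apply/disj_setPS => x [[_ nBx] [_ [Bx _]]].
- by move=> x _; exact: log_gap_ge0.
- exact: measurable_funS (mgapr _).
rewrite leeD2l//.
have mDB : measurable (B d `\` B d' : set X) by exact: measurableD.
have <- : nu D = (nu (B d) - nu (B d'))%E.
  have -> : nu (B d) = (nu D + nu (B d'))%E.
    rewrite (measureDI nu (mB d) (mB d')) (setIidr BB); congr (_ + _)%E.
    rewrite (measureDI nu mDB mY) /D (setIC Y).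
    rewrite (@subset_measure0 _ _ _ nu _ (~` Y)) ?add0e//.
    - exact: measurableD.
    - exact: measurableC.
  by rewrite -massE addeK.
rewrite muleC -integral_cst//.
apply: ge0_le_integral => //.
- by move=> x _; rewrite lee_fin ball_gap_ge0.
- exact: measurable_funS (mgapr _).
- move=> x [_ [Bx _]]; apply: ball_gap_le => //.
  by rewrite /chordal_ball /= (ker_typeI_self gE) ltW.
Qed.

(** The mass left in the smaller ball has its gap raised from [ball_gap d] to [ball_gap d'], that is
    by ln (d / d'). *)
Lemma gap_excess_mono d' d : 0 < d' <= d -> d < rho ->
  ball_mass d' * ln (d / d') <= gap_excess d - gap_excess d'.
Proof.
move=> dd dr; have := outer_gap_mono dd dr; have /andP[d'0 d'd] := dd.
have d0 := lt_le_trans d'0 d'd.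
rewrite ln_div ?posrE// /gap_excess /ball_gap; lra.
Qed.

(** The energy bound makes the gap energy of tau at most [ball_gap d + C]; [gap_energy_variation]
    then leaves C times the ball mass as the only surplus. *)
Lemma gap_excess_le d C (tau : probability X R) : 0 < d -> d < rho ->
  radon tau -> msupport tau `<=` E `&` B d ->
  ((ln d - C - 2 * ln s)%:E <= energy S0 tau)%E ->
  gap_excess d <= C * ball_mass d.
Proof.
move=> d0 dr rtau stau en.
have stauE : msupport tau `<=` E by move=> x /stau[].
have tauB : tau (~` B d) = 0%E.
  apply: (radon_null hausP1 rtau stau).
    by apply: closed_openC => x; exact: (ker_ball_closed gE).
  by move=> x nBx [_ /nBx].
have tauY : tau (~` Y) = 0%E by exact: (radon_null_off hausP1 rhoE cY rtau stauE).
have Jtau : (gap_energy S0 M tau <= (ball_gap d + C)%:E)%E.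
  move: en; rewrite (energyE v_nonarch v_nontrivial gE Y_pos Y_le mY)//.
    have : (0 <= gap_energy S0 M tau)%E.
      by apply: integral_ge0 => x _; exact: gap_potential_ge0.
    case: (gap_energy S0 M tau) => [j| |] //= _; rewrite -?EFinB ?lee_fin//.
    by rewrite /ball_gap; lra.
  exact: probability_setT.
have := @gap_energy_variation _ _ v v_nonarch v_nontrivial gE S0 M Y (B d) za mY (mB d)
  (fun x y Yx nBx _ By => gap_sep dr Yx nBx By) E nu hausP1 rhoE cY Y_pos Y_le
  nu_eq J_lty tau (probability_setT tau) rtau stauE tauB
  (le_lt_trans Jtau (ltry _)).
have -> : (\int[nu]_(x in ~` B d) log_gap S0 M x za)%E = (outer_gap d)%:E.
  rewrite outerE// (ge0_negligible_integral (measurableC mY))//.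
  - by rewrite setDE setCK setIC.
  - exact: measurableC.
  - exact: measurable_funS (mgapr _).
  - by move=> x _; exact: log_gap_ge0.
move=> h; have {}h : (J <= (outer_gap d)%:E + nu (B d) * (ball_gap d + C)%:E)%E.
  by apply: le_trans h _; rewrite leeD2l// lee_wpmul2l.
move: h; rewrite -massE -EFinM -EFinD -[J]fineK ?ge0_fin_numE// lee_fin.
rewrite /gap_excess; lra.
Qed.

(** Here M cancels: potential minus [robin] is J minus the gap potential at S, which is bounded
    below by splitting nu into the ball and its complement. *)
Lemma potential_ball d S : 0 < d -> d < rho -> B d S ->
  (potential S0 nu S - robin S0 E <= (gap_excess d)%:E)%E.
Proof.
move=> d0 dr BS.
have YS : Y S by rewrite /Y /= (sB dr BS) rhoE.
rewrite (potentialE v_nonarch v_nontrivial gE Y_pos Y_le mY (probability_setT nu) nuY YS).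
rewrite robinE.
have : ((outer_gap d)%:E + (ball_mass d)%:E * (ball_gap d)%:E <=
    gap_potential S0 M nu S)%E.
  rewrite /gap_potential -(setUCr (B d)) ge0_integral_setU//; last 4 first.
  - exact: measurableC.
  - by rewrite setUCr; exact: mgap.
  - by move=> x _; exact: log_gap_ge0.
  - by apply/disj_setPCl.
  rewrite addeC; apply: leeD; last first.
    rewrite massE muleC -integral_cst//; apply: ge0_le_integral => //.
    - by move=> x _; rewrite lee_fin ball_gap_ge0.
    - exact: measurable_funS (mgap _).
    - by move=> x Bx; exact: ball_gap_le.
  rewrite outerE//.
  apply: (@le_trans _ _ (\int[nu]_(x in Y `&` ~` B d) log_gap S0 M S x)%E).
    rewrite le_eqVlt; apply/orP; left; apply/eqP; apply: eq_integral => x.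
    rewrite inE => -[Yx nBx].
    by rewrite (log_gapC v_nonarch v_nontrivial gE S0 M S x) (gap_sep dr Yx nBx BS).
  apply: ge0_subset_integral => //.
  - exact: measurableC.
  - exact: measurable_funS (mgap _).
  - by move=> x _; exact: log_gap_ge0.
rewrite -[J]fineK ?ge0_fin_numE// /gap_excess.
have := gap_potential_ge0 S0 M nu S.
case: (gap_potential S0 M nu S) => [p| |] //= _; last by rewrite leNye.
by rewrite -EFinM -EFinD -!EFinB !lee_fin; lra.
Qed.

End Ball.

Lemma holder_bound : exists alpha A d1 : R, [/\ 0 < alpha, 0 < d1 &
  forall (a : option K) (d : R) S, E (typeI v a) -> 0 < d <= d1 ->
    chordal_ball a d S ->
    (potential S0 nu S - robin S0 E <= (A * d `^ alpha)%:E)%E].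
Proof.
have [C [d1 [C0 d10 d1r wit]]] := test_measures rho0 rhoE.
have [alpha [A [alpha0 decay]]] := holder_decay C0 d10.
exists alpha, A, d1; split => // a d S Ea dd1 BS.
have lt_rho t : t <= d1 -> t < rho by move=> /le_lt_trans; apply.
have /andP[d0 dle] := dd1.
apply: le_trans (potential_ball Ea d0 (lt_rho _ dle) BS) _.
rewrite lee_fin; apply: (decay (gap_excess a) (ball_mass a)) => //.
- move=> t tt; have /andP[t0 tle] := tt; split; first exact: ball_mass01.
  have [tau [rtau stau en]] := wit a t Ea tt.
  exact: (gap_excess_le Ea t0 (lt_rho _ tle) rtau stau en).
- by move=> t' t tt /lt_rho tr; exact: gap_excess_mono.
Qed.

End HolderBound.

(** * The degenerate case: the kernel falls back to the default 0 of [xget] *)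

Section NoExtension.
Context {R : realType} {K : closedFieldType} (v : absolute_value R K).
Hypothesis no_extension : ~ (exists g, chordal_extension (v := v) g).
Variables (S0 : berkP1 v) (nu : probability (borelP1 v) R).

Let integral_pinfty : (\int[nu]_x cst +oo x = +oo)%E.
Proof.
by rewrite integral_cst// [X in (_ * X)%E](probability_setT nu) mule1.
Qed.

Lemma potential_no_extension S : potential S0 nu S = +oo%E.
Proof.
have k0 : @chordal_kernel R K v = fun _ _ => 0.
  by rewrite /chordal_kernel xgetPN// => g gE; apply: no_extension; exists g.
rewrite -[RHS]integral_pinfty.
by apply: eq_integral => x _; rewrite /hsia k0 mul0r eqxx.
Qed.

Lemma energy_no_extension : energy S0 nu = +oo%E.
Proof.
rewrite -integral_pinfty.
by apply: eq_integral => x _; exact: potential_no_extension.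
Qed.

End NoExtension.

Theorem theorem4 (R : realType) (K : closedFieldType)
    (v : absolute_value R K)
    (v_nonarch : nonarchimedean_abs v) (v_nontrivial : nontrivial_abs v)
    (v_complete : complete_abs v)
    (E : set (berkP1 v)) (E_compact : compact E)
    (E_density : lower_capacity_density E)
    (S0 : berkP1 v) (S0_notin_E : ~ E S0)
    (E_capacity : (0 < capacity S0 E)%E)
    (nu : probability (borelP1 v) R) (nu_equilibrium : equilibrium S0 E nu) :
  let D := connected_component (~` E) S0 in
  exists alpha delta0 : R, [/\ 0 < alpha, 0 < delta0 &
    (ereal_sup
       [set ereal_sup
          [set ereal_sup
                 [set potential S0 nu S - lne (capacity S0 E)
                 | S in chordal_ball a delta]
               * ((delta `^ alpha)^-1)%:E
          | delta in [set delta : R | (0 < delta <= delta0)%R]]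
       | a in [set a : option K | frontier D (typeI v a)]] < +oo)%E].
Proof.
move=> D; rewrite /capacity expeRK.
(* A bound A d^alpha with A independent of a, d and S makes A an upper bound of the whole double
   supremum. *)
have bounded (alpha A delta0 : R) :
    (forall a d S, frontier D (typeI v a) -> 0 < d <= delta0 ->
       chordal_ball a d S ->
       (potential S0 nu S - robin S0 E <= (A * d `^ alpha)%:E)%E) ->
    (ereal_sup
       [set ereal_sup
          [set ereal_sup
                 [set potential S0 nu S - robin S0 E
                 | S in chordal_ball a delta]
               * ((delta `^ alpha)^-1)%:E
          | delta in [set delta : R | (0 < delta <= delta0)%R]]
       | a in [set a : option K | frontier D (typeI v a)]] < +oo)%E.
  move=> le_pot; apply: (@le_lt_trans _ _ A%:E); last by rewrite ltry.
  apply: ge_ereal_sup => _ [a fa <-]; apply: ge_ereal_sup => _ [d dd <-].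
  have /andP[d0 _] := dd; have p0 : 0 < d `^ alpha by exact: powR_gt0.
  rewrite lee_pdivrMr// -EFinM; apply: ge_ereal_sup => _ [S BS <-].
  exact: le_pot BS.
have [gex|nog] := pselect (exists g, chordal_extension (v := v) g); last first.
  (* Potential and energy are both +oo, and the extended difference +oo - +oo is -oo by
     convention. *)
  exists 1, 1; split => //; apply: (@bounded 1 0) => a d S _ _ _.
  have [_ _ <-] := nu_equilibrium.
  by rewrite potential_no_extension// energy_no_extension//; exact: leNye.
have gE : chordal_extension (@chordal_kernel R K v) by exact: xgetPex.
(* E is compact and misses [S0], so the continuous positive function g(., S0) has a positive lower
   bound on E. *)
have rho_ex := compact_pos_lbound (ker_continuousl gE (y := S0)) E_compact
  (fun x Ex => ker_gt0 v_nonarch v_nontrivial gE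
    (fun e => S0_notin_E (eq_ind x E Ex _ e))).
have [rho rho0 rhoE] := rho_ex.
have V : (-oo < robin S0 E)%E.
  by move: E_capacity; rewrite /capacity; case: (robin S0 E) => [r| |] //=; rewrite ?ltNyr ?ltxx.
have [alpha [A [d1 [alpha0 d10 bound]]]] := holder_bound v_nonarch v_nontrivial gE
  E_compact nu_equilibrium S0_notin_E V E_density rho0 rhoE.
exists alpha, d1; split => //; apply: (bounded alpha A) => a d S fa.
exact: bound (frontier_component_sub v_nonarch v_nontrivial gE E_compact fa).
Qed.
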